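(* Consider a discrete-time controlled Markov process satisfying conditions (A), (N) and (W) of the context, and assume that the process is irreducible under every stationary Markov control. Then there exists a function $\psi^*:S\to(0,\infty)$ satisfying $$e^{\lambda^*}\psi^*(i)\ \ge\ \min_{u\in\mathbb U(i)}\Big[e^{c(i,u)}\sum_{j\in S}\psi^*(j)P(j|i,u)\Big]\qquad\text{for all } i\in S .$$ Furthermore, $\lambda^*=\lambda_{\rm m}$, and every measurable selector $v\in\mathfrak U_{\mathsf{sm}}$ of the right-hand side (i.e. every $v$ such that $v(i)$ attains the minimum for each $i\in S$) is an optimal stationary Markov control.
   Context: Discrete-time controlled Markov process (DTCMP). The state space is $S=\{1,2,\dots\}$. The action space $\mathbb U$ is a Borel space; for each $i\in S$, $\mathbb U(i)\subset\mathbb U$ is a nonempty compact Borel set of admissible actions; $\mathscr K=\{(i,u):i\in S,\ u\in\mathbb U(i)\}$. $P(\cdot|i,u)$ is a stochastic kernel on $S$ depending measurably on $(i,u)\in\mathscr K$, $P(j|i,u)=P(\{j\}|i,u)$, and $c:\mathscr K\to[0,\infty)$ is the one-stage cost. A history up to time $t$ is $h_t=(x_0,u_0,\dots,x_{t-1},u_{t-1},x_t)$ with $(x_s,u_s)\in\mathscr K$, $x_t\in S$. An admissible control is a sequence $\zeta=(\zeta_t)_{t\ge0}$ of measurable maps from histories to $\mathbb U$ with $\zeta_t(h_t)\in\mathbb U(x_t)$; the set of these is $\mathfrak U$. For $i\in S$, $\zeta\in\mathfrak U$, $\mathbb P_i^\zeta$ (expectation $\mathbb E_i^\zeta$) is the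 unique probability measure on $(S\times\mathbb U)^\infty$ under which $X_0=i$ and, conditionally on the history up to time $t$ (with $\zeta_t$ also denoting the action used at time $t$), $X_{t+1}\in A$ with probability $P(A|X_t,\zeta_t)$. $\mathfrak U_{\mathsf{sm}}$ is the set of stationary Markov controls: $\zeta_t(h_t)=v(x_t)$ for a map $v:S\to\mathbb U$ with $v(i)\in\mathbb U(i)$; we identify the control with $v$. Cost: $\mathscr E_i(c,\zeta)=\limsup_{T\to\infty}\frac1T\log\mathbb E_i^\zeta\big[e^{\sum_{t=0}^{T-1}c(X_t,\zeta_t)}\big]$, $\lambda^*=\inf_{i\in S}\inf_{\zeta\in\mathfrak U}\mathscr E_i(c,\zeta)$ and $\lambda_{\rm m}=\inf_{i\in S}\inf_{v\in\mathfrak U_{\mathsf{sm}}}\mathscr E_i(c,v)$. A control $\zeta^*\in\mathfrak U$ is optimal if $\mathscr E_i(c,\zeta^* )=\lambda^*$ for all $i\in S$. (A) For each $i\in S$ and each bounded $f:S\to\mathbb R$, the maps $u\mapsto c(i,u)$ and $u\mapsto\sum_{j}f(j)P(j|i,u)$ are continuous on $\mathbb U(i)$. (N) (near-monotone cost) $\inf_{v\in\mathfrak U_{\mathsf{sm}}}\mathscr E_i(c,v)<\infty$ for all $i\in S$, and $\liminf_{n\to\infty}\inf_{k\ge n}\inf_{u\in\mathbb U(k)}c(k,u)>\lambda_{\rm m}$. (W) There exists $W:S\to[1,\infty)$ with $W(i)\ge i$ for all large $i$ and a function $g:S\to\mathbb R$ with $\lim_{i\to\infty}g(i)=0$ such that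 $\sup_{u\in\mathbb U(i)}\sum_{j\in S}(W(j)-W(i))P(j|i,u)\le g(i)$ for all $i\in S$. For some $\eta>0$, $\min_{u\in\mathbb U(i)}P(i-1|i,u)\ge\eta$ for all $i\ge2$. There is a finite set $C\subset S$, independent of $u$, such that $P(\cdot|1,u)$ is supported in $C$ for all $u\in\mathbb U(1)$. In addition, for every $n$, with $\mathscr D_n=\{1,\dots,n\}$, every $v\in\mathfrak U_{\mathsf{sm}}$ and every $j\in\mathscr D_n\setminus\{1\}$ there exist distinct $i_1,\dots,i_k\in\mathscr D_n$ (with $k=0$ allowed, meaning $P(j|1,v(1))>0$) such that $P(i_1|1,v(1))P(i_2|i_1,v(i_1))\cdots P(j|i_k,v(i_k))>0$. *)

(* Defs.v *)
From HB Require Import structures.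
From mathcomp Require Import all_boot all_order all_algebra.
From mathcomp Require Import all_classical all_reals all_analysis.
From mathcomp Require Import measurable_realfun.

Set Implicit Arguments.
Unset Strict Implicit.
Unset Printing Implicit Defensive.
Import Order.TTheory GRing.Theory Num.Theory.
Import numFieldTopology.Exports.

Local Open Scope classical_set_scope.
Local Open Scope ring_scope.
Local Open Scope ereal_scope.

(* The state space S = {1, 2, ...} is encoded by nat: the state k of S is
   k.-1 : nat. Hence the distinguished state 1 is 0, the number attached to
   the state i : nat is i.+1, and {1, ..., n} is [set i | (i < n)%N].
   The Borel space of actions is a Borel subset of a complete separable metric
   space X, given as a separable Hausdorff completePseudoMetricType (Hausdorff
   turns the pseudometric into a metric). *)

Definition separable (X : topologicalType) : Prop :=
  exists2 D : set X, countable D & dense D.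

(* X with its Borel sigma-algebra. *)
Definition borel (X : ptopologicalType) := g_sigma_algebraType (@open X).
HB.instance Definition _ (X : ptopologicalType) := Measurable.on (borel X).
HB.instance Definition _ (X : ptopologicalType) := Pointed.on (borel X).

Section dtcmp.
Context {R : realType} {X : completePseudoMetricType R}.

(* adm i is U(i). The kernel and the cost are only meaningful on
   K = {(i, u) | u in U(i)}; their values elsewhere are irrelevant. *)
Record dtcmp := Dtcmp {
  action_space : set (borel X) ;
  measurable_action_space : measurable action_space ;
  adm : nat -> set X ;
  adm_sub : forall i, adm i `<=` action_space ;
  adm_neq0 : forall i, adm i !=set0 ;
  measurable_adm : forall i, measurable (adm i : set (borel X)) ;
  compact_adm : forall i, compact (adm i) ;
  trans : nat -> X -> probability nat R ;
  measurable_trans : forall A : set nat, measurable_fun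
    [set iu : nat * borel X | adm iu.1 iu.2]
    (fun iu : nat * borel X => trans iu.1 iu.2 A) ;
  cost : nat -> X -> R ;
  cost_ge0 : forall i u, adm i u -> (0 <= cost i u)%R }.

(* (x_0, u_0, ..., x_(t-1), u_(t-1), x_t) *)
Definition history (t : nat) := (t.-tuple (nat * borel X) * nat)%type.

Definition control := forall t, history t -> borel X.

(* Sample paths (x_t, u_t)_t, with the product sigma-algebra. *)
Definition path_space := g_sigma_algebraType
  [set E : set (nat -> nat * borel X) | exists t (A : set (nat * borel X)),
    measurable A /\ E = [set w | A (w t)]].

Definition state (t : nat) (w : path_space) : nat := (w t).1.
Definition action (t : nat) (w : path_space) : borel X := (w t).2.
Definition hist (t : nat) (w : path_space) : history t :=
  ([tuple w i | i < t], state t w).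

Variable M : dtcmp.

Definition feasible (t : nat) : set (history t) :=
  [set h | forall s : 'I_t, adm M (tnth h.1 s).1 (tnth h.1 s).2].

Definition admissible (z : control) : Prop := forall t,
  measurable_fun (@feasible t) (z t) /\
  forall h, @feasible t h -> adm M h.2 (z t h).

Definition stationary_policy (v : nat -> X) : Prop := forall i, adm M i (v i).

Definition stationary (v : nat -> X) : control := fun t h => v h.2.

(* Defining properties of P_i^z; the last one says that, conditionally on the
   history up to time t, X_(t+1) has law P(. | X_t, z_t). *)
Definition is_path_law (i : nat) (z : control)
    (Pr : probability path_space R) : Prop :=
  [/\ Pr [set w | state 0 w = i] = 1,
      forall t, {ae Pr, forall w, action t w = z t (hist t w)} &
      forall t (B : set (history t)) (A : set nat),
        measurable B -> B `<=` @feasible t ->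
        Pr [set w | B (hist t w) /\ A (state t.+1 w)] =
        \int[Pr]_(w in hist t @^-1` B) trans M (state t w) (z t (hist t w)) A].

(* For admissible z the default is never used, see path_lawP below. *)
Definition path_law (i : nat) (z : control) : probability path_space R :=
  xget (dirac (point : path_space) : probability path_space R)
    (is_path_law i z).

(* The integrand is defined on the paths that stay in K, which carry all the
   mass of an admissible control. *)
Definition exp_cost (i : nat) (z : control) (T : nat) : \bar R :=
  \int[path_law i z]_(w in [set w | forall t, adm M (state t w) (action t w)])
    (expR (\sum_(t < T) cost M (state t w) (action t w)))%:E.

Definition risk (i : nat) (z : control) : \bar R :=
  limn_esup (fun T : nat => (T%:R^-1)%:E * lne (exp_cost i z T)).

Definition lambda_star : \bar R :=
  ereal_inf [set ereal_inf [set risk i z | z in admissible] | i in [set: nat]].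

Definition lambda_m : \bar R :=
  ereal_inf [set ereal_inf [set risk i (stationary v) | v in stationary_policy]
            | i in [set: nat]].

Definition optimal (z : control) : Prop :=
  admissible z /\ forall i, risk i z = lambda_star.

Definition irreducible (v : nat -> X) : Prop := forall i j, exists n,
  0 < path_law i (stationary v) [set w | state n w = j].

(* e^{c(i,u)} sum_j psi(j) P(j | i, u) *)
Definition bellman (psi : nat -> R) (i : nat) (u : X) : \bar R :=
  (expR (cost M i u))%:E * \sum_(j <oo) (psi j)%:E * trans M i u [set j].

Definition bellman_min (psi : nat -> R) (i : nat) (u : X) : Prop :=
  adm M i u /\ forall u', adm M i u' -> bellman psi i u <= bellman psi i u'.

Definition cond_A : Prop := forall i,
  {within adm M i, continuous (cost M i)} /\
  forall f : nat -> R, (exists b : R, forall j, (`|f j| <= b)%R) ->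
    {within adm M i, continuous
      (fun u => fine (\sum_(j <oo) (f j)%:E * trans M i u [set j]))}.

Definition cond_N : Prop :=
  (forall i, ereal_inf [set risk i (stationary v) | v in stationary_policy]
             < +oo) /\
  lambda_m < limn_einf (fun n => ereal_inf
    [set ereal_inf [set (cost M k u)%:E | u in adm M k] | k in [set k | n <= k]%N]).

(* P(s_1 | x, v(x)) P(s_2 | s_1, v(s_1)) ... *)
Fixpoint step_prob (v : nat -> X) (x : nat) (s : seq nat) : \bar R :=
  if s is y :: s' then trans M x (v x) [set y] * step_prob v y s' else 1.

Definition cond_W : Prop :=
  [/\ exists (W g : nat -> R),
        [/\ forall i, (1 <= W i)%R,
            \forall i \near \oo, (i.+1%:R <= W i)%R,
            g @ \oo --> (0 : R)%R &
            forall i, ereal_sup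
              [set \sum_(j <oo) (W j - W i)%:E * trans M i u [set j]
              | u in adm M i] <= (g i)%:E],
      exists2 eta : R, (0 < eta)%R & forall i u, adm M i.+1 u ->
        eta%:E <= trans M i.+1 u [set i],
      exists2 C : set nat, finite_set C &
        forall u, adm M 0 u -> trans M 0 u C = 1 &
      forall n v j, stationary_policy v -> (j < n)%N -> j <> 0%N ->
        exists s : seq nat, [/\ uniq s, all (fun k => k < n)%N s &
          0 < step_prob v 0 (rcons s j)]].

End dtcmp.
Arguments dtcmp {R} X.

(* Existence of P_i^z (Ionescu-Tulcea): under an admissible control the history
   is a function of the visited states, and these are realized on [0, 1[ with
   Lebesgue measure by nested intervals. *)
Local Close Scope ereal_scope.

Section random_words.
Context {R : realType} (p : seq nat -> probability nat R).
Implicit Types (s : seq nat) (t y : nat) (x : R).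

Let q s y : R := fine (p s [set y]).
Let F s (n : nat) : R := fine (p s [set k | (k < n)%N]).

Let qE s y : p s [set y] = (q s y)%:E.
Proof. by rewrite /q fineK// fin_num_measure. Qed.

Let FE s n : p s [set k | (k < n)%N] = (F s n)%:E.
Proof. by rewrite /F fineK// fin_num_measure. Qed.

Let q_ge0 s y : 0 <= q s y. Proof. exact/fine_ge0/measure_ge0. Qed.

Let F0 s : F s 0 = 0.
Proof.
by rewrite /F (_ : [set _ | _] = set0) ?measure0//; apply/seteqP; split.
Qed.

Let FS s n : F s n.+1 = F s n + q s n.
Proof.
apply: EFin_inj; rewrite EFinD -!FE -qE -measureU//.
- congr (p s _); apply/seteqP; split => k /=.
    by rewrite ltnS leq_eqVlt => /predU1P[->|]; [right|left].
  by move=> [/ltnW|->].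
- by apply/seteqP; split => // k [/= + kn]; rewrite kn ltnn.
Qed.

Let F_le s m n : (m <= n)%N -> F s m <= F s n.
Proof.
move=> mn; rewrite -lee_fin -!FE le_measure ?inE// => k /= km.
exact: leq_trans mn.
Qed.

Let F_cvg s : F s @ \oo --> (1 : R).
Proof.
suff /fine_cvgP[]: (fun n => p s [set k | (k < n)%N]) @ \oo --> (1 : R)%:E.
  by move=> _; exact.
rewrite -(probability_setT (p s)).
rewrite (_ : setT = \bigcup_n [set k | (k < n)%N]); last first.
  by apply/seteqP; split => // k _; exists k.+1 => //=.
apply: (nondecreasing_cvg_mu (mu := p s)) => // m n mn.
by apply/subsetPset => k /= km; exact: leq_trans mn.
Qed.

(* Words are in reverse order. al s is the pair of the left end and the length
   of the interval of the word s. *)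
Let Fixpoint al s : R * R := if s is y :: s' then
  ((al s').1 + (al s').2 * F s' y, (al s').2 * q s' y) else (0, 1).

Let itv s : set R := `[(al s).1, (al s).1 + (al s).2[%classic.

Let al_ge0 s : 0 <= (al s).2.
Proof. by elim: s => //= y s ih; rewrite mulr_ge0. Qed.

Let itvS s y x : itv (y :: s) x <->
  (al s).1 + (al s).2 * F s y <= x < (al s).1 + (al s).2 * F s y.+1.
Proof. by rewrite /itv/= in_itv/= FS mulrDr addrA. Qed.

Let itv_sub s y : itv (y :: s) `<=` itv s.
Proof.
move=> x /itvS /andP[h1 h2]; rewrite /itv/= in_itv/=; apply/andP; split.
  by rewrite (le_trans _ h1)// lerDl mulr_ge0//; rewrite -(F0 s) F_le.
rewrite (lt_le_trans h2)// lerD2l ler_piMr//.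
by rewrite -lee_fin -FE probability_le1.
Qed.

Let itv_ex s x : itv s x -> exists y, itv (y :: s) x.
Proof.
rewrite /itv/= in_itv/= => /andP[ax xal].
have cv : (al s).1 + (al s).2 * F s n @[n --> \oo] --> (al s).1 + (al s).2.
  rewrite -[X in _ --> _ + X]mulr1; apply: cvgD; first exact: cvg_cst.
  by apply: cvgM => //; exact: cvg_cst.
have ex : exists n, x < (al s).1 + (al s).2 * F s n.
  have [n _ /(_ n (leqnn n)) /= h] := cvgr_gt _ cv _ xal.
  by exists n.
case: (ex_minnP ex) => -[|n]; first by rewrite F0 mulr0 addr0 ltNge ax.
move=> xn min; exists n; apply/itvS; rewrite xn andbT leNgt; apply/negP => /min.
by rewrite ltnn.
Qed.

Let itv_inj s y y' x : itv (y :: s) x -> itv (y' :: s) x -> y = y'.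
Proof.
wlog: y y' / (y < y')%N => [hw|yy'].
  by case: (ltngtP y y') => // h a b; [|symmetry]; exact: hw.
move=> /itvS/andP[_ h1] /itvS/andP[h2 _]; exfalso.
have := le_lt_trans h2 h1; rewrite ltNge lerD2l ler_wpM2l//.
exact: F_le.
Qed.

Let next s x : nat := get [set y | itv (y :: s) x].

Let Fixpoint wd t x : seq nat :=
  if t is t'.+1 then next (wd t' x) x :: wd t' x else [::].

Let wdP t s x : itv [::] x -> wd t x = s <-> size s = t /\ itv s x.
Proof.
move=> x01; elim: t s => [|t ih] s /=.
  by split=> [<-//|[/size0nil->]].
split=> [<-|].
  have [st ix] := (ih _).1 erefl; rewrite /= st; split => //.
  have [y iy] := itv_ex ix.
  exact: (@getI _ [set y | itv (y :: wd t x) x] y).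
case: s => [[]//|y s] /= [[st] ix].
rewrite (ih s).2; last by split => //; exact: itv_sub ix.
congr cons; apply: (@itv_inj s _ _ x) => //.
exact: (@getI _ [set y | itv (y :: s) x] y).
Qed.

Let clip x : R := if (0 <= x < 1) then x else 0.

Let clipE x : itv [::] x -> clip x = x.
Proof. by rewrite /itv/= in_itv/= add0r /clip => ->. Qed.

Let itv_clip x : itv [::] (clip x).
Proof.
by rewrite /itv/= in_itv/= add0r /clip; case: ifPn => // _; rewrite lexx ltr01.
Qed.

Let word t x := wd t (clip x).

Let mitv s : measurable (itv s : set (measurableTypeR R)).
Proof. exact: measurable_itv. Qed.

Let measurable_word t s :
  measurable ([set x | word t x = s] : set (measurableTypeR R)).
Proof.
rewrite (_ : [set _ | _] =
    itv [::] `&` [set x | wd t x = s] `|`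
    ~` itv [::] `&` [set x | word t 0 = s]); last first.
  apply/seteqP; split => x /=; rewrite /word.
    have [ix|nix] := pselect (itv [::] x); first by rewrite clipE//; left.
    move=> <-; right; split => //; congr wd.
    move: nix; rewrite /itv/= in_itv/= add0r /clip => /negP/negbTE ->.
    by rewrite lexx ltr01.
  move=> [[ix <-]|[nix <-]]; first by rewrite clipE.
  congr wd; move: nix; rewrite /itv/= in_itv/= add0r /clip => /negP/negbTE ->.
  by rewrite lexx ltr01.
apply: measurableU; last first.
  apply: measurableI; first exact: measurableC (mitv _).
  have [e|ne] := pselect (word t 0 = s).
    by rewrite (_ : [set _ | _] = setT)//; apply/seteqP; split.
  by rewrite (_ : [set _ | _] = set0)//; apply/seteqP; split.
have [st|nst] := pselect (size s = t); last first.
  rewrite (_ : _ `&` _ = set0)//; apply/seteqP; split => // x [ix /=].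
  by move/(wdP _ _ ix) => [].
rewrite (_ : _ `&` _ = itv [::] `&` itv s).
  by apply: measurableI; exact: mitv.
apply/seteqP; split => x [ix] /=.
  by move/(wdP _ _ ix) => [].
by move=> h; split => //; apply/(wdP _ _ ix).
Qed.

Let mu0 := mrestr (@lebesgue_measure R) (mitv [::]).

Let mu0T : mu0 setT = 1%E.
Proof.
rewrite /mu0 /mrestr setTI; apply: eq_trans (lebesgue_measure_itv _) _ => /=.
by rewrite add0r lte_fin ltr01 oppr0 adde0.
Qed.

Let mu1 : probability (measurableTypeR R) R :=
  HB.pack (mrestr (@lebesgue_measure R) (mitv [::])) (Measure_isProbability.Build _ _ _ _ mu0T).

Let mu0_word t s : mu0 [set x | word t x = s] =
  if size s == t then (al s).2%:E else 0%E.
Proof.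
rewrite /mu0 /mrestr; case: eqP => st; last first.
  rewrite (_ : _ `&` _ = set0) ?measure0//; apply/seteqP; split => // x /= [+ ix].
  by rewrite /word clipE// => /(wdP _ _ ix)[].
have sub : forall s', itv s' `<=` itv [::].
  by elim=> // y s' ih; apply: subset_trans ih; exact: itv_sub.
rewrite (_ : _ `&` _ = itv s); last first.
  apply/seteqP; split => x /=; rewrite /word.
    by move=> [+ ix]; rewrite clipE// => /(wdP _ _ ix)[].
  move=> ix; split; last exact: sub ix.
  rewrite clipE; last exact: sub ix.
  by apply/wdP => //; exact: sub ix.
apply: eq_trans (lebesgue_measure_itv _) _ => /=.
rewrite lte_fin ltrDl -EFinD addrAC subrr add0r.
by case: ifPn => //; rewrite -leNgt => h; congr EFin; apply/le_anti; rewrite al_ge0 h.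
Qed.

Lemma random_words : exists (mu : probability (measurableTypeR R) R)
    (w : nat -> measurableTypeR R -> seq nat),
  [/\ forall x, w 0 x = [::],
      forall t x, w t.+1 x = head 0%N (w t.+1 x) :: w t x,
      forall t s, measurable [set x | w t x = s] &
      forall t s y, mu [set x | w t.+1 x = y :: s] =
                    (mu [set x | w t x = s] * p s [set y])%E].
Proof.
exists mu1, word; split=> // t s y; rewrite -[LHS]/(mu0 _) -[X in (X * _)%E]/(mu0 _).
rewrite !mu0_word/= eqSS; case: ifPn => _; last by rewrite mul0e.
by rewrite qE -EFinM.
Qed.

End random_words.

Local Open Scope ereal_scope.

Lemma measurable_fun_pair_dom d d1 d2 (T : measurableType d)
    (T1 : measurableType d1) (T2 : measurableType d2) (D : set T)
    (f : T -> T1) (g : T -> T2) :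
  measurable_fun D f -> measurable_fun D g ->
  measurable_fun D (fun x => (f x, g x)).
Proof.
move=> mf mg mD; move: (mD); apply: measurability; first by reflexivity.
by move=> _ [_ [[A mA <-]|[A mA <-]] <-]; rewrite setTI; [exact: mf|exact: mg].
Qed.

Section path_law_exists.
Context {R : realType} {X : completePseudoMetricType R}.
Variables (M : @dtcmp R X) (hausX : hausdorff_space X) (i : nat).
Variables (z : @control R X) (z_adm : admissible M z).
Local Notation path_space := (@path_space R X).

Let measurable_coord t : measurable_fun [set: path_space]
  (fun w : path_space => (w t : nat * borel X)).
Proof.
move=> _ A mA; rewrite setTI; apply: sub_sigma_algebra.
by exists t, A.
Qed.

Let measurable_state t : measurable_fun [set: path_space] (@state R X t).
Proof. exact: measurableT_comp measurable_fst (measurable_coord t). Qed.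

Let measurable_hist t : measurable_fun [set: path_space] (@hist R X t).
Proof.
apply/measurable_fun_pairP; split; last exact: measurable_state.
apply/measurable_fun_tnthP => k.
rewrite (_ : _ \o _ = fun w : path_space => w k); first exact: measurable_coord.
by apply/funext => w /=; rewrite tnth_mktuple.
Qed.

Let measurable_K : measurable [set iu : nat * borel X | adm M iu.1 iu.2].
Proof.
rewrite (_ : [set _ | _] = \bigcup_k ([set k] `*` (adm M k : set (borel X)))).
  by apply: bigcupT_measurable => k; apply: measurableX => //; exact: measurable_adm.
apply/seteqP; split=> -[k u] /=; first by move=> ku; exists k.
by case=> k' _ [/= ->].
Qed.

Let measurable_feasible t : measurable (@feasible R X M t).
Proof.
rewrite (_ : @feasible R X M t = \bigcap_(k : 'I_t)
    ((fun h : history t => tnth h.1 k) @^-1`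
      [set iu : nat * borel X | adm M iu.1 iu.2])).
  apply: fin_bigcap_measurable => // k _; rewrite -[X in measurable X]setTI.
  apply: (measurableT_comp (measurable_tnth k) measurable_fst) => //.
by apply/seteqP; split => h /= hk k; [move=> _|]; exact: hk.
Qed.

Let measurable_pt (c : nat * borel X) : measurable [set c].
Proof.
case: c => k u; rewrite (_ : [set _] = [set k] `*` [set u]).
  apply: measurableX => //; rewrite -[X in measurable X]setCK.
  apply: measurableC; apply: sub_sigma_algebra; apply: closed_openC.
  exact: accessible_closed_set1 (hausdorff_accessible hausX) _.
by apply/seteqP; split=> [_ ->//|[a b] /= [-> ->]].
Qed.

Let rec := ((nat -> nat * borel X) * nat)%type.

Let hr t (r : rec) : history t := ([tuple r.1 k | k < t], r.2).

Let Fixpoint run (s : seq nat) : rec := if s is y :: s' then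
  let r := run s' in
  (fun k => if k == size s' then (r.2, z (hr (size s') r)) else r.1 k, y)
  else (fun=> point, i).

Let p (s : seq nat) := trans M (run s).2 (z (hr (size s) (run s))).

Theorem path_law_exists : exists Pr, is_path_law M i z Pr.
Proof.
have [mu [w [w0 wS mw wp]]] := random_words p.
have size_w t x : size (w t x) = t by elim: t => [|t]; rewrite ?w0// wS/= => ->.
pose W x : path_space := fun t => ((run (w t x)).2, z (hr t (run (w t x)))).
have runW t x k : (k < t)%N -> (run (w t x)).1 k = W x k.
  elim: t => // t ih; rewrite ltnS wS /= size_w; case: ltngtP => //= [kt _|-> _].
    exact: ih.
  by [].
have histW t x : hist t (W x) = hr t (run (w t x)).
  congr pair; apply: eq_from_tnth => k; rewrite !tnth_mktuple/=.
  by rewrite runW.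
have mcst d (T : measurableType d) (Q : Prop) : measurable [set _ : T | Q].
  have [q|nq] := pselect Q.
    by rewrite (_ : [set _ | _] = setT)//; apply/seteqP; split.
  by rewrite (_ : [set _ | _] = set0)//; apply/seteqP; split.
have mword t (Q : set (seq nat)) : measurable [set x | Q (w t x)].
  rewrite (_ : [set _ | _] = \bigcup_s ([set x | w t x = s] `&` [set _ | Q s])).
    apply: countable_bigcupT_measurable => // s.
    by apply: measurableI => //; exact: mcst.
  by apply/seteqP; split=> x /=; [move=> Qx; exists (w t x)|case=> s _ [<-]].
have mW : measurable_fun [set: measurableTypeR R] W.
  apply: measurability; first by reflexivity.
  move=> _ [_ [t [A [mA ->]] <-]].
  rewrite setTI.
  exact: (mword t [set s | A ((run s).2, z (hr t (run s)))]).
pose Wm : {mfun measurableTypeR R >-> path_space} :=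
  HB.pack W (isMeasurableFun.Build _ _ _ _ _ mW).
exists (distribution mu Wm); split.
- rewrite /distribution /pushforward/= -[RHS](probability_setT mu).
  by congr (mu _); apply/seteqP; split => x //= _; rewrite /W /state/= w0.
- move=> t; pose G := \bigcup_(s : seq nat) ([set _ | size s = t] `&`
    \bigcap_(k in `I_t.+1) [set u : path_space | u k = (run (0%N :: s)).1 k]).
  have mG : measurable G.
    apply: countable_bigcupT_measurable => // s; apply: measurableI; first exact: mcst.
    apply: bigcap_measurable; first by exists 0%N.
    move=> k _; rewrite -[X in measurable X]setTI.
    exact: (measurable_coord _ _ (measurable_pt _)).
  exists (~` G); split; first exact: measurableC.
    rewrite /distribution /pushforward/= -[RHS](measure0 mu); congr (mu _).
    apply/seteqP; split => x //= /(_ _)[]; exists (w t x) => //; split => //= k /= kt.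
    rewrite size_w; case: eqP => [->//|/eqP nkt].
    by rewrite runW// ltn_neqAle nkt.
  apply: subsetC => u [s _ [/= st us]].
  have uk k : (k < t)%N -> u k = (run s).1 k.
    by move=> kt; rewrite us/= ?st ?ltn_eqF// ltnS ltnW.
  have ut := us t (ltnSn t); rewrite /= st eqxx in ut.
  rewrite /action ut/=; congr (z _); congr pair; last by rewrite /state ut.
  by apply: eq_from_tnth => k; rewrite !tnth_mktuple uk.
- move=> t B A mB BF.
  have mE : measurable (W @^-1` (hist t @^-1` B)).
    rewrite (_ : _ @^-1` _ = [set x | B (hr t (run (w t x)))]).
      exact: (mword t [set s | B (hr t (run s))]).
    by apply/seteqP; split => x /=; rewrite histW.
  have mhB : measurable (@hist R X t @^-1` B).
    by rewrite -[X in measurable X]setTI; exact: measurable_hist.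
  have mf : measurable_fun (@hist R X t @^-1` B)
      (fun u => trans M (state t u) (z (hist t u)) A).
    apply: (@measurable_comp _ _ _ _ _ _
      [set iu : nat * borel X | adm M iu.1 iu.2]
      (fun iu : nat * borel X => trans M iu.1 iu.2 A) _
      (fun u : path_space => (state t u, z (hist t u)))) => //.
    - by move=> _ [u /= Bu <-] /=; exact: (z_adm t).2 _ (BF _ Bu).
    - exact: measurable_trans.
    - apply: measurable_fun_pair_dom; first by apply: measurable_funTS; exact: measurable_state.
      apply: (@measurable_comp _ _ _ _ _ _ (@feasible R X M t)).
      + exact: measurable_feasible.
      + by move=> _ [u /= Bu <-]; exact: BF.
      + exact: (z_adm t).1.
      + by apply: measurable_funTS; exact: measurable_hist.
  rewrite [RHS](ge0_integral_pushforward mW)//=.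
  rewrite /distribution /pushforward/= -/(W @^-1` _).
  set E := W @^-1` (hist t @^-1` B) in mE *.
  set C := W @^-1` _.
  pose Z n := [set x | pickle (w t x) = n].
  have mZ n : measurable (Z n) by exact: (mword t [set s | pickle s = n]).
  have tZ : trivIset setT Z by exact: trivIset_preimage1.
  have UZ : \bigcup_n Z n = setT.
    by apply/seteqP; split => x // _; exists (pickle (w t x)).
  have mC : measurable C.
    rewrite (_ : C = E `&` [set x | A (run (w t.+1 x)).2]); last first.
      by apply/seteqP; split.
    by apply: measurableI => //; exact: (mword t.+1 [set s | A (run s).2]).
  have EZ : E = \bigcup_n (Z n `&` E) by rewrite -setI_bigcupl UZ setTI.
  have CZ : C = \bigcup_n (Z n `&` C) by rewrite -setI_bigcupl UZ setTI.
  rewrite CZ measure_semi_bigcup//; last 3 first.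
  - by move=> n; exact: measurableI.
  - exact: trivIset_setIr.
  - by rewrite -CZ.
  rewrite {1}EZ ge0_integral_bigcup//; last 3 first.
  - by move=> n; exact: measurableI.
  - rewrite -EZ; apply: (@measurable_comp _ _ _ _ _ _ (@hist R X t @^-1` B)
      (fun u => trans M (state t u) (z (hist t u)) A) _ W) => //.
      by move=> _ [x Ex <-].
    exact: measurable_funTS.
  - exact: trivIset_setIr.
  apply: eq_eseriesr => n _.
  have [[x0 [Zx0 Ex0]]|ZE0] := pselect (Z n `&` E !=set0); last first.
    rewrite (_ : Z n `&` E = set0); last first.
      by apply/seteqP; split => // x ZEx; apply: ZE0; exists x.
    rewrite integral_set0 (_ : _ `&` _ = set0) ?measure0//.
    by apply/seteqP; split => // x [Zx [Bx _]]; apply: ZE0; exists x.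
  pose s := w t x0.
  have ZnE : Z n = [set x | w t x = s].
    rewrite /Z -Zx0; apply/seteqP; split => x /=; last by move=> ->.
    by move/(pcan_inj pickleK).
  have BE : B (hr t (run s)) by rewrite -histW.
  have ZE : Z n `&` E = Z n.
    apply/seteqP; split => x; first by case.
    by rewrite ZnE /= => xs; split => //; rewrite /E/= histW xs.
  rewrite ZE (eq_integral (cst (p s A))); last first.
    move=> x; rewrite ZnE inE => /= xs.
    by rewrite histW /state /W/= xs /p size_w.
  rewrite integral_cst// (_ : _ `&` _ = \bigcup_(y in A) [set x | w t.+1 x = y :: s]).
    rewrite measure_bigcup//; last first.
      by move=> y y' _ _ [x []] /= -> [].
    have -> : p s A = \sum_(y <oo | y \in A) p s [set y].
      rewrite -measure_bigcup//; last by move=> y y' _ _ [x []] /= -> ->.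
      congr (p s _); apply/seteqP; split => y; first by move=> Ay; exists y.
      by case=> y' Ay' ->.
    have mun : mu (Z n) \is a fin_num by rewrite fin_num_measure.
    rewrite muleC -[X in _ = X * _](fineK mun) -nneseriesZl//.
    by apply: eq_eseriesr => y _; rewrite /= wp -ZnE fineK.
  apply/seteqP; split => x /=.
    rewrite ZnE => -[/= xs [_]]; rewrite /W /state/= => Ax.
    exists (run (w t.+1 x)).2 => //=.
    by move: Ax; rewrite wS/= xs.
  case=> y Ay /= xy; have xs : w t x = s by move: xy; rewrite wS => -[].
  rewrite ZnE; split => //; split; last by rewrite /state /W xy.
  by rewrite -[hist _ _]/(hist t (W x)) histW xs.
Qed.

Lemma path_lawP : is_path_law M i z (path_law M i z).
Proof. by have [Pr] := path_law_exists; exact: xgetI. Qed.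

End path_law_exists.

(* Main.v *)
Require Import Defs.
From HB Require Import structures.
From mathcomp Require Import all_boot all_order all_algebra.
From mathcomp Require Import all_classical all_reals all_analysis.
From mathcomp Require Import measurable_realfun.
From mathcomp Require Import ring lra.
Import numFieldTopology.Exports.
Local Open Scope classical_set_scope.
Local Open Scope ring_scope.
Local Open Scope ereal_scope.
Set Implicit Arguments.
Unset Strict Implicit.
Unset Printing Implicit Defensive.
Import Order.TTheory GRing.Theory Num.Theory.

(** The proof builds a supersolution [psi] of the multiplicative Bellman equation
    at the rate [lambda_star] directly from value functions, and then shows that
    [psi] is bounded away from zero, which is what makes its selectors optimal.

    Fix a rate [lam] above [lambda_star]. Some admissible control has, from some
    initial state, expected weights E[exp(c_0 + ... + c_(T-1))] growing at a rate
    below [lam] ([weight], [pcost]), so the sum over T of exp(- lam T) times these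
    weights is finite. Minimizing this sum is a total cost problem. Value
    iteration increases to a function [value M lam >= 1], which is a
    supersolution at the rate [lam] by Fatou's lemma, continuity and compactness
    ([value_super]), and which lies below the cost of every control by the
    Markov property ([integral_weightS], [viter_le_costs]). It is finite at one
    state, hence everywhere: steps to the left neighbour have probability at
    least eta, and every state can be reached from state 0 ([value_fin_num]).

    Normalize these functions at state 0 and let [lam] decrease to [lambda_star].
    The steps to the left bound them below, and the paths from state 0 bound them
    above, locally uniformly; an ultrafilter limit is a positive supersolution
    [psi] at the rate [lambda_star] ([super_limit]).

    Let [v] select minimizers for [psi]. Iterating the supersolution inequality
    gives E[weight T * psi(X_T)] <= exp(lambda_star T) psi(i), so [v] has rate at
    most [lambda_star] once [psi >= m > 0] ([pcost_stationary_le]). The lower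
    bound follows from the near-monotone cost and the drift of [W]. Outside a finite set the cost exceeds
    [lambda_star] by some de > 0, so that by Jensen's inequality [ln psi] drops by
    at least de on average, and [ln psi + b W] drops by at least de / 2, as the
    drift of [W] tends to zero. This function is bounded below, because
    [psi] decays at most geometrically and [W] dominates the identity. A minimum
    principle for [psi + ka (ln psi + b W)] with ka -> 0 shows that [psi] attains
    its infimum on the finite set ([super_bounded_below]).

    Finally [lambda_star <= lambda_m], since stationary controls are admissible,
    and a selector [v] has rate at most [lambda_star], so both are equal and every
    selector is optimal. *)

(** * Integrals weighted by a function of a map *)

Section integral_comp_density.
Context d d' (T : measurableType d) (S : measurableType d') (R : realType).
Variables (mu : {measure set T -> \bar R}) (phi : T -> S) (F : set S).
Hypotheses (mphi : measurable_fun setT phi) (mF : measurable F).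
Import HBNNSimple.

Let mpre B : measurable B -> measurable (phi @^-1` B).
Proof. by move=> mB; rewrite -[X in measurable X]setTI; exact: mphi. Qed.

Let integral_sfun (g : {nnsfun S >-> R}) (p : T -> \bar R) :
  measurable_fun (phi @^-1` F) p -> (forall x, F (phi x) -> 0 <= p x) ->
  \int[mu]_(x in phi @^-1` F) ((g (phi x))%:E * p x) =
  \sum_(y \in range g) y%:E * \int[mu]_(x in phi @^-1` (F `&` g @^-1` [set y])) p x.
Proof.
move=> mp p0.
have mi y : measurable_fun (phi @^-1` F)
    (fun x => (\1_(g @^-1` [set y]) (phi x) : R)%:E * p x).
  apply: emeasurable_funM => //; apply/measurable_EFinP.
  by apply: measurable_funTS; apply: measurableT_comp.
transitivity (\int[mu]_(x in phi @^-1` F) (\sum_(y \in range g)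
    y%:E * ((\1_(g @^-1` [set y]) (phi x) : R)%:E * p x))).
  apply: eq_integral => x _; rewrite {1}fimfunE -fsumEFin// ge0_mule_fsuml; last first.
    by move=> y; rewrite lee_fin; apply: nnfun_muleindic_ge0.
  by apply: eq_fsbigr => y _; rewrite EFinM -muleA.
rewrite ge0_integral_fsum//; last 3 first.
- exact: mpre.
- by move=> y; exact: measurable_funeM.
- move=> y x Fx; rewrite muleA mule_ge0 ?p0//.
  exact: (nnfun_muleindic_ge0 g y (phi x)).
apply: eq_fsbigr => y; rewrite inE /= => -[s _ gsy].
have y0 : (0 <= y)%R by rewrite -gsy.
rewrite ge0_integralZl//; last 2 first.
- exact: mpre.
- by move=> x Fx; rewrite mule_ge0 ?p0// lee_fin indicE.
congr (_ * _).
rewrite preimage_setI integral_mkcondr; apply: eq_integral => x _.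
rewrite /patch indicE; case: ifPn => xB.
  by rewrite mem_set ?mul1e//; move: xB; rewrite inE.
by rewrite memNset ?mul0e//; move: xB; rewrite notin_setE.
Qed.

(** Turns the defining property of the path law, an identity over events of the
    history, into one for integrands weighted by a function of the history.
    Both sides are monotone limits over simple functions of [phi], for which the
    identity is the hypothesis on preimages. *)
Lemma eq_integral_comp_mul (h : S -> \bar R) (p q : T -> \bar R) :
  measurable_fun F h -> (forall s, F s -> 0 <= h s) ->
  measurable_fun (phi @^-1` F) p ->
  (forall x, F (phi x) -> 0 <= p x /\ p x \is a fin_num) ->
  measurable_fun (phi @^-1` F) q ->
  (forall x, F (phi x) -> 0 <= q x /\ q x \is a fin_num) ->
  (forall B, measurable B -> B `<=` F ->
    \int[mu]_(x in phi @^-1` B) p x = \int[mu]_(x in phi @^-1` B) q x) ->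
  \int[mu]_(x in phi @^-1` F) (h (phi x) * p x) =
  \int[mu]_(x in phi @^-1` F) (h (phi x) * q x).
Proof.
move=> mh h0 mp p0 mq q0 pq.
pose g := nnsfun_approx mF mh.
have lim r : measurable_fun (phi @^-1` F) r ->
    (forall x, F (phi x) -> 0 <= r x /\ r x \is a fin_num) ->
    \int[mu]_(x in phi @^-1` F) (h (phi x) * r x) =
    limn (fun n => \int[mu]_(x in phi @^-1` F) ((g n (phi x))%:E * r x)).
  move=> mr r0; rewrite -monotone_convergence//.
  - apply: eq_integral => x; rewrite inE => Fx; apply/esym/cvg_lim => //.
    apply: cvgeZr; first exact: (r0 x Fx).2.
    exact: cvg_nnsfun_approx.
  - exact: mpre.
  - move=> n; apply: emeasurable_funM => //; apply/measurable_EFinP.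
    by apply: measurable_funTS; exact: measurableT_comp.
  - by move=> n x Fx; rewrite mule_ge0 ?(r0 x Fx).1// lee_fin.
  - move=> x Fx m n mn; rewrite lee_wpmul2r ?(r0 x Fx).1// lee_fin.
    by have /lefP := nd_nnsfun_approx mF mh mn; exact.
rewrite !lim//; congr (limn _); apply/funext => n.
rewrite !integral_sfun//; last 2 first.
- by move=> x /q0[].
- by move=> x /p0[].
apply: eq_fsbigr => y _; congr (_ * _).
by apply: pq; [exact: measurableI|exact: subIsetl].
Qed.

End integral_comp_density.

(** * One step of the controlled process *)

Lemma eseries_single (R : realType) (a : nat -> \bar R) k :
  0 <= a k -> (forall j, j != k -> a j = 0) -> \sum_(j <oo) a j = a k.
Proof.
move=> ak0 a0; rewrite (nneseriesD1 (n := k))// => [|j _].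
  by rewrite eseries0 ?adde0// => j _ /= /a0.
by have [->//|/a0->] := eqVneq j k.
Qed.

Section one_step.
Context {R : realType} {X : completePseudoMetricType R}.
Variable M : dtcmp X.
Hypothesis hA : cond_A M.
Local Notation path_space := (@path_space R X).

(** The Bellman expression for functions with values in [[0, +oo]], as needed
    for value functions before they are known to be finite;
    [lop M (EFin \o psi)] is convertible to [bellman M psi]. *)
Definition lop (f : nat -> \bar R) (i : nat) (u : X) : \bar R :=
  (expR (cost M i u))%:E * \sum_(j <oo) f j * trans M i u [set j].

Definition feasible_paths : set path_space :=
  [set w | forall t, adm M (state t w) (action t w)].

Definition weight (T : nat) (w : path_space) : R :=
  expR (\sum_(t < T) cost M (state t w) (action t w)).

Lemma trans_fin_num i u A : trans M i u A \is a fin_num.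
Proof. exact: fin_num_measure. Qed.

Lemma series_trans_ge0 (f : nat -> \bar R) i u : (forall j, 0 <= f j) ->
  0 <= \sum_(j <oo) f j * trans M i u [set j].
Proof. by move=> f0; apply: nneseries_ge0 => j _ _; rewrite mule_ge0. Qed.

Lemma lop_ge0 f i u : (forall j, 0 <= f j) -> 0 <= lop f i u.
Proof.
by move=> f0; rewrite mule_ge0 ?lee_fin ?expR_ge0// series_trans_ge0.
Qed.

Local Notation K := [set iu : nat * borel X | adm M iu.1 iu.2].

Lemma KE : K = \bigcup_k ([set k] `*` (adm M k : set (borel X))).
Proof.
apply/seteqP; split=> -[k u] /=; first by move=> ku; exists k.
by case=> k' _ [/= ->].
Qed.

Lemma measurable_K : measurable K.
Proof.
rewrite KE; apply: bigcupT_measurable => k.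
by apply: measurableX => //; exact: measurable_adm.
Qed.

(** Continuity on the slice [adm M k] gives Borel preimages of open intervals
    because relatively open subsets of a measurable set are measurable. *)
Lemma measurable_cost_slice k :
  measurable_fun (adm M k : set (borel X)) (cost M k : borel X -> R).
Proof.
apply: (measurability _ (RGenOpens.measurableE R)).
move=> _ [_ [a [b ->] <-]].
have /continuousP/(_ `]a, b[%classic (interval_open _ _)) := (hA k).1.
move=> /(_ isT isT) /open_subspaceP[V oV VD]; rewrite setIC -VD.
by apply: measurableI; [exact: sub_sigma_algebra|exact: measurable_adm].
Qed.

Lemma measurable_cost :
  measurable_fun K (fun iu : nat * borel X => cost M iu.1 iu.2).
Proof.
rewrite KE; apply/measurable_fun_bigcup => [k|k].
  by apply: measurableX => //; exact: measurable_adm.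
move=> mD Y mY.
rewrite (_ : _ `&` _ = [set k] `*` ((adm M k : set (borel X)) `&`
    (cost M k : borel X -> R) @^-1` Y)).
  by apply: measurableX => //; apply: measurable_cost_slice => //; exact: measurable_adm.
by apply/seteqP; split => -[k' u] /= [] => [[-> ? ?]|-> [? ?]].
Qed.

Lemma measurable_coord t : measurable_fun [set: path_space]
  (fun w : path_space => (w t : nat * borel X)).
Proof.
move=> _ A mA; rewrite setTI; apply: sub_sigma_algebra.
by exists t, A.
Qed.

Lemma measurable_state t : measurable_fun [set: path_space] (@state R X t).
Proof. exact: measurableT_comp measurable_fst (measurable_coord t). Qed.

Lemma measurable_hist t : measurable_fun [set: path_space] (@hist R X t).
Proof.
apply/measurable_fun_pairP; split; last exact: measurable_state.
apply/measurable_fun_tnthP => k.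
rewrite (_ : _ \o _ = fun w : path_space => w k); first exact: measurable_coord.
by apply/funext => w /=; rewrite tnth_mktuple.
Qed.

Lemma measurable_feasible t : measurable (@feasible R X M t).
Proof.
rewrite (_ : @feasible R X M t = \bigcap_(k : 'I_t)
    ((fun h : history t => tnth h.1 k) @^-1` K)).
  apply: fin_bigcap_measurable => // k _; rewrite -[X in measurable X]setTI.
  by apply: (measurableT_comp (measurable_tnth k) measurable_fst) => //; exact: measurable_K.
by apply/seteqP; split => h /= hk k; [move=> _|]; exact: hk.
Qed.

Lemma measurable_feasible_paths : measurable feasible_paths.
Proof.
rewrite (_ : feasible_paths = \bigcap_t ((fun w : path_space => w t) @^-1` K)).
  apply: bigcapT_measurable => t; rewrite -[X in measurable X]setTI.
  by apply: measurable_coord => //; exact: measurable_K.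
by apply/seteqP; split => w /= wK t; [move=> _|]; exact: wK.
Qed.

Lemma measurable_comp_coord d (S : measurableType d) t (f : nat * borel X -> S) :
  measurable_fun K f ->
  measurable_fun feasible_paths (fun w : path_space => f (w t)).
Proof.
move=> mf; apply: (@measurable_comp _ _ _ _ _ _ K f) => //.
- exact: measurable_K.
- by move=> _ [w wD <-]; exact: wD.
- by apply: measurable_funTS; exact: measurable_coord.
Qed.

Lemma measurable_weight T : measurable_fun feasible_paths (weight T).
Proof.
apply: measurableT_comp => //; apply: measurable_sum => t.
exact: (measurable_comp_coord t measurable_cost).
Qed.

Lemma measurable_trans_path t A : measurable_fun feasible_paths
  (fun w => trans M (state t w) (action t w) A).
Proof. exact: (measurable_comp_coord t (measurable_trans (d:=M) A)). Qed.

Lemma measurable_state_fun d (S : measurableType d) (f : nat -> S) t :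
  measurable_fun [set: path_space] (fun w : path_space => f (state t w)).
Proof. by apply: (measurableT_comp _ (measurable_state t)). Qed.

Lemma weight_ge0 T w : (0 <= weight T w)%R. Proof. exact: expR_ge0. Qed.

Lemma weightS T w :
  weight T.+1 w = (weight T w * expR (cost M (state T w) (action T w)))%R.
Proof. by rewrite /weight big_ord_recr/= expRD. Qed.

Section law.
Variables (i : nat) (z : @control R X) (Pr : probability path_space R).
Hypotheses (zadm : admissible M z) (lawPr : is_path_law M i z Pr).

Lemma null_off_control : exists N : set path_space,
  [/\ measurable N, Pr N = 0 &
      forall w, ~ N w -> forall t, action t w = z (hist t w)].
Proof.
have [_ ae _] := lawPr.
have /ae_foralln [N [mN N0 sN]] := ae.
by exists N; split => // w Nw t; apply: contrapT => h; apply: Nw; apply: sN => /= wz; exact/h/wz.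
Qed.

(** Induction on time: a feasible history forces a feasible action, which
    extends the feasible history. *)
Lemma feasible_of_control (w : path_space) :
  (forall t, action t w = z (hist t w)) -> feasible_paths w.
Proof.
move=> wz; suff h t : @feasible R X M t (hist t w).
  by move=> t; rewrite wz; exact: ((zadm t).2 _ (h t)).
elim: t => [|t ih]; first by case.
move=> s; rewrite tnth_mktuple.
have [st|] := ltnP s t.
  by have := ih (Ordinal st); rewrite tnth_mktuple.
move=> ts; have -> : nat_of_ord s = t by apply/eqP; rewrite eqn_leq ts -ltnS ltn_ord.
rewrite [adm _ _ _]/(adm M (state t w) (action t w)) wz.
exact: ((zadm t).2 _ ih).
Qed.

Lemma prob_feasible_paths : Pr feasible_paths = 1.
Proof.
have [N [mN N0 Nz]] := null_off_control.
have Nsub : ~` N `<=` feasible_paths.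
  by move=> w /Nz /feasible_of_control.
have mD := measurable_feasible_paths.
have PN : Pr (~` N) = 1 by rewrite probability_setC// N0 sube0.
apply/eqP; rewrite eq_le probability_le1//= -[leLHS]PN.
by rewrite le_measure ?inE//; exact: measurableC.
Qed.

Lemma integral_null_eq (A B N : set path_space) (f g : path_space -> \bar R) :
  measurable A -> measurable B -> measurable N -> Pr N = 0 ->
  ~` N `<=` A -> ~` N `<=` B ->
  measurable_fun A f -> measurable_fun B g ->
  (forall w, A w -> 0 <= f w) -> (forall w, B w -> 0 <= g w) ->
  (forall w, ~ N w -> f w = g w) ->
  \int[Pr]_(w in A) f w = \int[Pr]_(w in B) g w.
Proof.
move=> mA mB mN N0 NA NB mf mg f0 g0 fg.
rewrite (ge0_negligible_integral mN)// [RHS](ge0_negligible_integral mN)//.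
have -> : A `\` N = ~` N by rewrite setDE; exact/setIidPr.
have -> : B `\` N = ~` N by rewrite setDE; exact/setIidPr.
by apply: eq_integral => w; rewrite inE => /fg.
Qed.

(** The Markov property integrated against the accumulated weight. The weight
    [weight T.+1] involves the action at time [T], but almost surely this action
    is [z (hist T w)], so the weight agrees with a function [h] of the history
    and [eq_integral_comp_mul] applies. *)
Lemma integral_weight_next T j :
  \int[Pr]_(w in feasible_paths)
    ((weight T.+1 w)%:E * (\1_[set w' | state T.+1 w' = j] w)%:E) =
  \int[Pr]_(w in feasible_paths)
    ((weight T.+1 w)%:E * trans M (state T w) (action T w) [set j]).
Proof.
have [N [mN N0 Nz]] := null_off_control.
pose F := @feasible R X M T.
have mF : measurable F by exact: measurable_feasible.
have mpF : measurable (hist T @^-1` F).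
  by rewrite -[X in measurable X]setTI; exact: measurable_hist.
have feasP w : feasible_paths w -> F (hist T w).
  by move=> wD t; rewrite tnth_mktuple; exact: wD.
pose h (x : history T) : \bar R :=
  (expR (\sum_(t < T) cost M (tnth x.1 t).1 (tnth x.1 t).2) *
   expR (cost M x.2 (z x)))%:E.
have mzK : measurable_fun F (fun x : history T => (x.2, z x)).
  apply: measurable_fun_pair_dom; last exact: (zadm T).1.
  by apply: measurable_funTS; exact: measurable_snd.
have zK : (fun x : history T => (x.2, z x)) @` F `<=` K.
  by move=> _ [x Fx <-] /=; exact: ((zadm T).2 x Fx).
have mh : measurable_fun F h.
  apply/measurable_EFinP; apply: measurable_funM.
    apply: measurableT_comp => //; apply: measurable_sum => t.
    apply: (@measurable_comp _ _ _ _ _ _ K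
      (fun iu : nat * borel X => cost M iu.1 iu.2) _ (fun x : history T => tnth x.1 t)).
    - exact: measurable_K.
    - by move=> _ [x Fx <-]; exact: Fx.
    - exact: measurable_cost.
    - by apply: measurable_funTS; exact: (measurableT_comp (measurable_tnth t) measurable_fst).
  apply: measurableT_comp => //.
  exact: (measurable_comp measurable_K zK measurable_cost mzK).
have hw w : ~ N w -> h (hist T w) = (weight T.+1 w)%:E.
  move=> /Nz wz; rewrite weightS /h /weight /= -wz.
  by congr (expR _ * _)%:E; apply: eq_bigr => t _; rewrite tnth_mktuple.
have NF : ~` N `<=` feasible_paths by move=> w /Nz /feasible_of_control.
have mE : measurable [set w : path_space | state T.+1 w = j].
  rewrite -[X in measurable X]setTI.
  by apply: (@measurable_state T.+1 measurableT [set j]).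
pose q (w : path_space) := trans M (state T w) (z (hist T w)) [set j].
have mq : measurable_fun (hist T @^-1` F) q.
  pose k (x : history T) := trans M x.2 (z x) [set j].
  have mk : measurable_fun F k.
    exact: (measurable_comp measurable_K zK (measurable_trans (d := M) [set j]) mzK).
  apply: (@measurable_comp _ _ _ _ _ _ F k _ (@hist R X T)) => //.
    by move=> _ [w Fw <-].
  by apply: measurable_funTS; exact: measurable_hist.
have mp : measurable_fun (hist T @^-1` F)
    (fun w : path_space => (\1_[set w' | state T.+1 w' = j] w : R)%:E).
  by apply/measurable_EFinP; apply: measurable_funTS; exact: measurable_indic.
have mhh : measurable_fun (hist T @^-1` F) (fun w => h (hist T w)).
  apply: (@measurable_comp _ _ _ _ _ _ F h _ (@hist R X T)) => //.
    by move=> _ [w Fw <-].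
  by apply: measurable_funTS; exact: measurable_hist.
have mw : measurable_fun feasible_paths (fun w => (weight T.+1 w)%:E).
  by apply/measurable_EFinP; exact: measurable_weight.
have h0 x : 0 <= h x by rewrite lee_fin mulr_ge0 ?expR_ge0.
have NF' : ~` N `<=` hist T @^-1` F by move=> w /NF /feasP.
have mD := measurable_feasible_paths.
transitivity (\int[Pr]_(w in hist T @^-1` F)
    (h (hist T w) * (\1_[set w' | state T.+1 w' = j] w)%:E)).
  apply: (integral_null_eq (N := N)) => //.
  - apply: emeasurable_funM => //; apply/measurable_EFinP.
    by apply: measurable_funTS; exact: measurable_indic.
  - exact: emeasurable_funM.
  - by move=> w _; apply: mule_ge0; rewrite lee_fin ?weight_ge0// indicE.
  - by move=> w _; apply: mule_ge0; rewrite ?h0// lee_fin indicE.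
  - by move=> w /hw ->.
transitivity (\int[Pr]_(w in hist T @^-1` F) (h (hist T w) * q w)).
  apply: eq_integral_comp_mul => //.
  - exact: measurable_hist.
  - by move=> w _; rewrite /q; split => //; exact: trans_fin_num.
  - move=> B mB BF; rewrite integral_indic//; last first.
      by rewrite -[X in measurable X]setTI; exact: measurable_hist.
    have [_ _ /(_ T B [set j] mB BF) <-] := lawPr.
    by congr (Pr _); apply/seteqP; split => w /= [].
apply: (integral_null_eq (N := N)) => //.
- exact: emeasurable_funM.
- by apply: emeasurable_funM => //; exact: measurable_trans_path.
- by move=> w _; apply: mule_ge0; rewrite ?h0//; exact: measure_ge0.
- by move=> w _; apply: mule_ge0; rewrite ?lee_fin ?weight_ge0//; exact: measure_ge0.
- by move=> w Nw; rewrite (hw w Nw) /q (Nz w Nw).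
Qed.

(** The dynamic programming identity: decompose over the value of the next
    state and exchange sum and integral. *)
Lemma integral_weightS f T : (forall j, 0 <= f j) ->
  \int[Pr]_(w in feasible_paths) ((weight T.+1 w)%:E * f (state T.+1 w)) =
  \int[Pr]_(w in feasible_paths)
    ((weight T w)%:E * lop f (state T w) (action T w)).
Proof.
move=> f0; have mD := measurable_feasible_paths.
have mw : measurable_fun feasible_paths (fun w => (weight T.+1 w)%:E).
  by apply/measurable_EFinP; exact: measurable_weight.
have mE j : measurable [set w : path_space | state T.+1 w = j].
  rewrite -[X in measurable X]setTI.
  by apply: (@measurable_state T.+1 measurableT [set j]).
have mp j : measurable_fun feasible_paths
    (fun w : path_space => (\1_[set w' | state T.+1 w' = j] w : R)%:E).
  by apply/measurable_EFinP; apply: measurable_funTS; exact: measurable_indic.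
have w0 w : 0 <= (weight T.+1 w)%:E by rewrite lee_fin weight_ge0.
have i0 j (w : path_space) : 0 <= (\1_[set w' | state T.+1 w' = j] w : R)%:E.
  by rewrite lee_fin indicE.
transitivity (\sum_(j <oo) f j * \int[Pr]_(w in feasible_paths)
    ((weight T.+1 w)%:E * (\1_[set w' | state T.+1 w' = j] w)%:E)).
  under eq_eseriesr => j _.
    rewrite -ge0_integralZl//; last 2 first.
    - exact: emeasurable_funM.
    - by move=> w _; rewrite mule_ge0.
    over.
  rewrite -integral_nneseries//; last 2 first.
  - by move=> j; apply: measurable_funeM; exact: emeasurable_funM.
  - by move=> j w _; rewrite !mule_ge0.
  apply: eq_integral => w _; rewrite (eseries_single (k := state T.+1 w)).
  - by rewrite indicE mem_set// mule1 muleC.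
  - by rewrite !mule_ge0.
  - by move=> j jw; rewrite indicE memNset ?mule0//= => e; rewrite e eqxx in jw.
under eq_eseriesr => j _.
  rewrite integral_weight_next -ge0_integralZl//; last 2 first.
  - by apply: emeasurable_funM => //; exact: measurable_trans_path.
  - by move=> w _; rewrite mule_ge0.
  over.
rewrite -integral_nneseries//; last 2 first.
- move=> j; apply: measurable_funeM; apply: emeasurable_funM => //.
  exact: measurable_trans_path.
- by move=> j w _; rewrite !mule_ge0.
apply: eq_integral => w _; rewrite /lop muleA -EFinM -weightS.
rewrite -nneseriesZl; last by move=> j _; rewrite mule_ge0.
by apply: eq_eseriesr => j _; rewrite muleCA.
Qed.

End law.
End one_step.

(** * Limits along an ultrafilter and minimizing actions *)

Lemma ultra_on_oo : exists2 U : set_system nat, UltraFilter U & \oo `<=` U.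
Proof. by have [U [UU sU]] := ultraFilterLemma (@eventually_filter); exists U. Qed.

(** Replaces diagonal extraction of subsequences: one ultrafilter on the indices
    makes the actions at all states, and later all the values, converge at once.
    It contains every set of indices or the complement, so it converges to any
    of its cluster points. *)
Lemma ultra_compact_cvg (T : topologicalType) (A : set T) (U : set_system nat)
    (u : nat -> T) : UltraFilter U -> compact A -> U [set n | A (u n)] ->
  exists2 x, A x & u @ U --> x.
Proof.
move=> UU cA uA; have [x [Ax clx]] := cA (u @ U) _ uA.
exists x => // V Vx; have [//|UV] := in_ultra_setVsetC (u @^-1` V) UU.
have [y [] //] := clx (~` V) V UV Vx.
Qed.

Lemma within_cvg (T T' : topologicalType) (A : set T) (f : T -> T') I
    (U : set_system I) (u : I -> T) x : Filter U ->
  {within A, continuous f} -> A x -> (forall n, A (u n)) -> u @ U --> x ->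
  (fun n => f (u n)) @ U --> f x.
Proof.
move=> FU /subspace_continuousP/(_ x)/[swap] Ax /(_ Ax) fA uA ux V /fA VA.
have UV : U [set n | A (u n) -> V (f (u n))] := ux _ VA.
by apply: (filterS (F := U)) UV => n /= /(_ (uA n)).
Qed.

Section closure.
Context {R : realType} {X : completePseudoMetricType R}.
Variable M : dtcmp X.
Hypothesis hA : cond_A M.
Variables (U : set_system nat).
Hypothesis UU : UltraFilter U.

Lemma series_indicator i u j :
  \sum_(k <oo) ((k == j)%:R : R)%:E * trans M i u [set k] = trans M i u [set j].
Proof.
rewrite (eseries_single (k := j)) ?eqxx ?mul1e// => k /negbTE ->.
by rewrite mul0e.
Qed.

Section along.
Variables (i : nat) (u : nat -> X) (x : X).
Hypotheses (Ax : adm M i x) (Au : forall n, adm M i (u n)) (ux : u @ U --> x).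

Lemma cost_cvg : (fun n => cost M i (u n)) @ U --> cost M i x.
Proof. exact: within_cvg (hA i).1 Ax Au ux. Qed.

Lemma trans_cvg j :
  (fun n => trans M i (u n) [set j]) @ U --> trans M i x [set j].
Proof.
have b : exists b : R, forall k, (`|((k == j)%:R : R)| <= b)%R.
  by exists 1%R => k; case: eqP; rewrite ?normr1 ?normr0.
have := within_cvg (@ultra_proper _ _ UU) ((hA i).2 _ b) Ax Au ux.
under eq_cvg do rewrite series_indicator.
rewrite series_indicator => h.
rewrite -(fineK (trans_fin_num M i x [set j])); apply: cvg_EFin h.
by apply: filterE => n; exact: trans_fin_num.
Qed.

(** Fatou's lemma, with transition probabilities and functions varying together.
    A term whose limit probability vanishes while [f j] is infinite need not
    converge to the product of the limits, hence the minorant [s] below. *)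
Lemma lop_le_lim (f_ : nat -> nat -> \bar R) (f : nat -> \bar R)
    (a_ : nat -> R) (a : R) :
  (forall n j, 0 <= f_ n j) -> (forall j, (fun n => f_ n j) @ U --> f j) ->
  a_ @ U --> a -> (forall n, lop M (f_ n) i (u n) <= (a_ n)%:E) ->
  lop M f i x <= a%:E.
Proof.
move=> f_0 f_f a_a le.
have f0 j : 0 <= f j by apply: cvge_ge (f_f j); exact: filterE.
rewrite /lop -nneseriesZl; last by move=> j _; rewrite mule_ge0.
apply: lime_le.
  by apply: is_cvg_nneseries => j _ _; rewrite !mule_ge0// lee_fin expR_ge0.
apply: nearW => N.
pose s n j := if trans M i x [set j] == 0 then 0 else
  (expR (cost M i (u n)))%:E * (f_ n j * trans M i (u n) [set j]).
have s_cvg j : (fun n => s n j) @ U -->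
    (expR (cost M i x))%:E * (f j * trans M i x [set j]).
  rewrite /s; case: eqP => [->|/eqP p0].
    by rewrite !mule0; exact: cvg_cst.
  have pgt0 : 0 < trans M i x [set j] by rewrite lt_neqAle eq_sym p0 measure_ge0.
  have fp : (fun n => f_ n j * trans M i (u n) [set j]) @ U -->
      f j * trans M i x [set j].
    apply: cvgeM => //; last exact: trans_cvg.
    have [fj|fj] := boolP (f j \is a fin_num); last exact: mule_def_infty_neq0.
    by apply: mule_def_fin => //; exact: trans_fin_num.
  apply: cvgeM => //.
    have [yf|yf] := boolP (f j * trans M i x [set j] \is a fin_num).
      exact: mule_def_fin.
    by apply: mule_def_neq0_infty => //; rewrite gt_eqF// lte_fin expR_gt0.
  apply: cvg_EFin; first by apply: filterE.
  by apply: continuous_cvg; [exact: continuous_expR|exact: cost_cvg].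
have s0 n j : 0 <= s n j.
  by rewrite /s; case: ifPn => // _; rewrite !mule_ge0// lee_fin expR_ge0.
have s_le n : \sum_(0 <= j < N) s n j <= (a_ n)%:E.
  apply: le_trans (le n); rewrite /lop -nneseriesZl; last first.
    by move=> j _; rewrite mule_ge0.
  apply: (@le_trans _ _ (\sum_(0 <= j < N)
      (expR (cost M i (u n)))%:E * (f_ n j * trans M i (u n) [set j]))).
    apply: lee_sum => j _; rewrite /s; case: ifPn => // _.
    by rewrite !mule_ge0// lee_fin expR_ge0.
  by apply: nneseries_lim_ge => j _; rewrite !mule_ge0// lee_fin expR_ge0.
have S_cvg : (fun n => \sum_(0 <= j < N) s n j) @ U -->
    \sum_(0 <= j < N) (expR (cost M i x))%:E * (f j * trans M i x [set j]).
  by apply: cvg_nnesum => [j _|j _]; [exact: filterE|exact: s_cvg].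
have a_E : (fun n => (a_ n)%:E) @ U --> a%:E.
  by apply: cvg_EFin => //; exact: filterE.
rewrite -sube_ge0; last by rewrite orbT.
have D := cvgeB (fin_num_adde_defr _ (isT : a%:E \is a fin_num)) a_E S_cvg.
by apply: cvge_ge (D _); apply: filterE => n; rewrite sube_ge0// orbT.
Qed.

End along.

(** Compactness of the action set supplies a limit action to which [lop_le_lim]
    applies. *)
Lemma lop_lim_attained i (f_ : nat -> nat -> \bar R) (f : nat -> \bar R)
    (a_ : nat -> R) (a : R) :
  (forall n j, 0 <= f_ n j) -> (forall j, (fun n => f_ n j) @ U --> f j) ->
  a_ @ U --> a ->
  (forall n, exists2 u, adm M i u & lop M (f_ n) i u <= (a_ n)%:E) ->
  exists2 u, adm M i u & lop M f i u <= a%:E.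
Proof.
move=> f_0 f_f a_a /(_ _)/cid2-/all_sig2[u Au le].
have UA : U [set n | adm M i (u n)] by apply: (filterE (F := U)).
have [x Ax ux] := ultra_compact_cvg UU (@compact_adm _ _ M i) UA.
by exists x => //; exact: lop_le_lim le.
Qed.

End closure.

Section minimizer.
Context {R : realType} {X : completePseudoMetricType R}.
Variable M : dtcmp X.
Hypothesis hA : cond_A M.

Lemma lop_min (f : nat -> \bar R) i : (forall j, 0 <= f j) ->
  exists2 u, adm M i u & forall u', adm M i u' -> lop M f i u <= lop M f i u'.
Proof.
move=> f0; pose S := [set lop M f i u | u in adm M i].
have [u0 Au0] := adm_neq0 M i.
have Sle u : adm M i u -> ereal_inf S <= lop M f i u.
  by move=> Au; apply: ereal_inf_lbound; exists u.
have S0 : 0 <= ereal_inf S.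
  by apply: le_ereal_inf_tmp => _ [u _ <-]; exact: lop_ge0.
have [Sy|Sfin] := eqVneq (ereal_inf S) +oo.
  exists u0 => // u' /Sle; rewrite Sy => h.
  by move: h; rewrite leye_eq => /eqP ->; exact: leey.
have Sn : ereal_inf S \is a fin_num by rewrite ge0_fin_numE// ltey.
have [U UU sU] := ultra_on_oo.
have [||n|u Au le] := @lop_lim_attained _ _ _ hA U UU i (fun=> f) f
    (fun n => fine (ereal_inf S) + n.+1%:R^-1)%R (fine (ereal_inf S)) (fun=> f0).
- by move=> j; exact: cvg_cst.
- have h : (fine (ereal_inf S) + n.+1%:R^-1)%R @[n --> \oo] --> fine (ereal_inf S).
    rewrite -[X in _ --> X]addr0; apply: cvgD; first exact: cvg_cst.
    exact: cvg_harmonic.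
  by move=> V /h; exact: sU.
- have [||_ [u Au <-] lt] := @lb_ereal_inf_adherent _ S n.+1%:R^-1.
  + by rewrite invr_gt0.
  + exact: Sn.
  by exists u => //; rewrite EFinD fineK// ltW.
by exists u => // u' /Sle; apply: le_trans; rewrite -(fineK Sn).
Qed.

End minimizer.

(** * Value iteration for the discounted total cost *)

Section value_iteration.
Context {R : realType} {X : completePseudoMetricType R}.
Variable M : dtcmp X.
Hypothesis hA : cond_A M.

Lemma le_lop (f g : nat -> \bar R) i u : (forall j, 0 <= f j) ->
  (forall j, f j <= g j) -> lop M f i u <= lop M g i u.
Proof.
move=> f0 fg; rewrite lee_wpmul2l// ?lee_fin ?expR_ge0//.
apply: lee_nneseries => [j _ _|j _]; first by rewrite mule_ge0.
by rewrite lee_wpmul2r.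
Qed.

(** Dynamic programming for minimizing the sum over [T < n] of
    [expR (- lam * T) * E[weight T]]. *)
Fixpoint viter (lam : R) (n : nat) (i : nat) : \bar R :=
  if n is n'.+1 then
    1 + (expR (- lam))%:E * ereal_inf [set lop M (viter lam n') i u | u in adm M i]
  else 0.

Definition value lam i := ereal_sup (range (fun n => viter lam n i)).

Lemma viter_ge0 lam n i : 0 <= viter lam n i.
Proof.
elim: n i => //= n ih i; rewrite adde_ge0// mule_ge0 ?lee_fin ?expR_ge0//.
by apply: le_ereal_inf_tmp => _ [u _ <-]; exact: lop_ge0.
Qed.

Lemma viter_nd lam i : {homo (fun n => viter lam n i) : m n / (m <= n)%N >-> m <= n}.
Proof.
apply: homo_leq => //; first by move=> ? ? ?; exact: le_trans.
move=> n; elim: n i => [|n ih] i; first exact: viter_ge0.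
rewrite [leLHS]/= [leRHS]/= leeD2l// lee_wpmul2l ?lee_fin ?expR_ge0//.
apply: le_ereal_inf_tmp => _ [u Au <-].
apply: le_trans (le_lop _ _ (viter_ge0 lam n) ih).
by apply: ereal_inf_lbound; exists u.
Qed.

Lemma viter_le_value lam n i : viter lam n i <= value lam i.
Proof. by apply: ereal_sup_ubound; exists n. Qed.

Lemma value_ge1 lam i : 1 <= value lam i.
Proof.
apply: le_trans (viter_le_value lam 1 i); rewrite /= leeDl//.
apply: mule_ge0; first by rewrite lee_fin expR_ge0.
by apply: le_ereal_inf_tmp => _ [u _ <-]; exact: lop_ge0.
Qed.

(** Passing to the limit in the recursion for [viter] gives a supersolution for
    the rate [lam], with a selector, whether or not the value is finite. *)
Lemma value_super lam i :
  exists2 u, adm M i u & lop M (value lam) i u <= (expR lam)%:E * value lam i.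
Proof.
have v0 j : 0 <= value lam j by apply: le_trans (value_ge1 lam j).
have [vy|vfin] := eqVneq (value lam i) +oo.
  have [u Au] := adm_neq0 M i; exists u => //.
  by rewrite vy gt0_muley ?leey// lte_fin expR_gt0.
have fv : value lam i \is a fin_num by rewrite ge0_fin_numE// ltey.
have [U UU sU] := ultra_on_oo.
rewrite -(fineK fv) -EFinM.
apply: (lop_lim_attained hA UU (f_ := viter lam)
  (a_ := fun=> (expR lam * fine (value lam i))%R)).
- by move=> n j; exact: viter_ge0.
- by move=> j V /(ereal_nondecreasing_cvgn (@viter_nd lam j)); exact: sU.
- exact: cvg_cst.
move=> n; have [u Au umin] := lop_min hA i (viter_ge0 lam n).
exists u => //; rewrite EFinM fineK//.
rewrite -lee_pdivrMl ?expR_gt0// -expRN.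
apply: le_trans (viter_le_value lam n.+1 i); rewrite /= -[leLHS]add0e leeD//.
rewrite lee_wpmul2l ?lee_fin ?expR_ge0//.
by apply: le_ereal_inf_tmp => _ [u' Au' <-]; exact: umin.
Qed.

Section law.
Variables (i : nat) (z : @control R X) (Pr : probability (@path_space R X) R).
Hypotheses (zadm : admissible M z) (lawPr : is_path_law M i z Pr).

Definition pcost T := \int[Pr]_(w in feasible_paths M) (weight M T w)%:E.

Lemma integral_weight0 (f : nat -> \bar R) : (forall j, 0 <= f j) ->
  \int[Pr]_(w in feasible_paths M) ((weight M 0 w)%:E * f (state 0 w)) = f i.
Proof.
move=> f0; have mD := measurable_feasible_paths M.
have mE : measurable [set w : @path_space R X | state 0 w = i].
  rewrite -[X in measurable X]setTI.
  by apply: (@measurable_state R X 0 measurableT [set i]).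
have PD := prob_feasible_paths zadm lawPr.
have [PE _ _] := lawPr.
rewrite -[RHS]mule1 -[in RHS]PD -integral_cst//.
apply: (integral_null_eq (N := ~` feasible_paths M `|` ~` [set w | state 0 w = i])) => //.
- by apply: measurableU; exact: measurableC.
- have ND : Pr (~` feasible_paths M) = 0 by rewrite probability_setC// PD subee.
  have NE : Pr (~` [set w | state 0 w = i]) = 0 by rewrite probability_setC// PE subee.
  by apply: etrans (measureU0 _ _ NE) _ => //; exact: measurableC.
- by rewrite setCU !setCK; exact: subIsetl.
- by rewrite setCU !setCK; exact: subIsetl.
- apply: emeasurable_funM; last by apply: measurable_funTS; exact: measurable_state_fun.
  by apply/measurable_EFinP; exact: measurable_weight.
- by move=> w _; rewrite mule_ge0// lee_fin weight_ge0.
- by move=> w _; exact: f0.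
- move=> w Nw.
  have -> : state 0 w = i by apply: contrapT => wi; apply: Nw; right.
  by rewrite /weight big_ord0 expR0 mul1e.
Qed.

Lemma weight_ge1 T w : feasible_paths M w -> (1 <= weight M T w)%R.
Proof.
move=> wD; rewrite -expR0 ler_expR sumr_ge0// => t _.
by apply: cost_ge0; exact: wD.
Qed.

Lemma measurable_EFin_weight T :
  measurable_fun (feasible_paths M) (fun w => (weight M T w)%:E).
Proof. by apply/measurable_EFinP; exact: measurable_weight. Qed.

Lemma pcost_ge1 T : 1 <= pcost T.
Proof.
have mD := measurable_feasible_paths M.
rewrite -[leLHS](prob_feasible_paths zadm lawPr) -[leLHS]mul1e -integral_cst//.
apply: ge0_le_integral => //; last by move=> w /(weight_ge1 T); rewrite lee_fin.
exact: measurable_EFin_weight.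
Qed.

Lemma pcost_nd : {homo pcost : m n / (m <= n)%N >-> m <= n}.
Proof.
apply: homo_leq => //; first by move=> ? ? ?; exact: le_trans.
move=> n; apply: ge0_le_integral.
- exact: measurable_feasible_paths.
- by move=> w _; rewrite lee_fin weight_ge0.
- exact: measurable_EFin_weight.
- exact: measurable_EFin_weight.
- move=> w wD; rewrite lee_fin weightS ler_peMr ?weight_ge0//.
  by rewrite -expR0 ler_expR cost_ge0//; exact: wD.
Qed.

Lemma measurable_lop_path f T : (forall j, 0 <= f j) ->
  measurable_fun (feasible_paths M) (fun w => lop M f (state T w) (action T w)).
Proof.
move=> f0; apply: emeasurable_funM.
  apply/measurable_EFinP; apply: measurableT_comp => //.
  exact: (measurable_comp_coord T (measurable_cost hA)).
apply: ge0_emeasurable_sum => [j w _ _|j _].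
  by rewrite mule_ge0.
by apply: measurable_funeM; exact: measurable_trans_path.
Qed.

(** The recursion bounds [viter] at the current state by the cost of any action,
    in particular of the one actually taken; iterate with [integral_weightS]. *)
Lemma viter_verification lam m T :
  \int[Pr]_(w in feasible_paths M)
    ((weight M T w)%:E * viter lam m (state T w)) <=
  \sum_(k < m) (expR (- lam) ^+ k)%:E * pcost (T + k).
Proof.
have mD := measurable_feasible_paths M.
have w0 t w : 0 <= (weight M t w)%:E by rewrite lee_fin weight_ge0.
have v0 := viter_ge0 lam.
elim: m T => [|m ih] T.
  by rewrite big_ord0 integral0_eq// => w _; rewrite mule0.
have l0 w : 0 <= lop M (viter lam m) (state T w) (action T w) by exact: lop_ge0.
apply: (@le_trans _ _ (\int[Pr]_(w in feasible_paths M) ((weight M T w)%:E +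
    (expR (- lam))%:E *
    ((weight M T w)%:E * lop M (viter lam m) (state T w) (action T w))))).
  apply: ge0_le_integral => //.
  - by move=> w _; apply: mule_ge0; [exact: w0|exact: v0].
  - apply: emeasurable_funM; first exact: measurable_EFin_weight.
    by apply: measurable_funTS; exact: measurable_state_fun.
  - apply: emeasurable_funD; first exact: measurable_EFin_weight.
    apply: measurable_funeM; apply: emeasurable_funM.
      exact: measurable_EFin_weight.
    exact: measurable_lop_path.
  - move=> w wD; rewrite muleCA -[X in X + _]mule1 -ge0_muleDr//; last first.
      by apply: mule_ge0; [rewrite lee_fin expR_ge0|exact: l0].
    rewrite lee_wpmul2l ?w0//= leeD2l// lee_wpmul2l ?lee_fin ?expR_ge0//.
    by apply: ereal_inf_lbound; exists (action T w) => //; exact: wD.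
rewrite ge0_integralD//; last 3 first.
- exact: measurable_EFin_weight.
- move=> w _; apply: mule_ge0; first by rewrite lee_fin expR_ge0.
  by apply: mule_ge0; [exact: w0|exact: l0].
- apply: measurable_funeM; apply: emeasurable_funM.
    exact: measurable_EFin_weight.
  exact: measurable_lop_path.
rewrite big_ord_recl/= expr0 mul1e addn0 leeD2l//.
rewrite ge0_integralZl//; last 2 first.
- apply: emeasurable_funM; first exact: measurable_EFin_weight.
  exact: measurable_lop_path.
- by move=> w _; apply: mule_ge0; [exact: w0|exact: l0].
rewrite -(integral_weightS hA zadm lawPr)//.
apply: le_trans (lee_wpmul2l _ (ih T.+1)) _; first by rewrite lee_fin expR_ge0.
rewrite ge0_sume_distrr; last first.
  by move=> k _; rewrite mule_ge0 ?lee_fin ?exprn_ge0 ?expR_ge0// integral_ge0.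
apply: lee_sum => k _; rewrite muleA -EFinM -exprS /bump/= addSnnS.
by rewrite add1n.
Qed.

Lemma viter_le_costs lam m :
  viter lam m i <= \sum_(k < m) (expR (- lam) ^+ k)%:E * pcost k.
Proof.
have := viter_verification lam m 0.
rewrite integral_weight0//; exact: viter_ge0.
Qed.

End law.

End value_iteration.

(** * Exponential growth rates *)

Section growth_rate.
Context {R : realType}.
Implicit Types (E : nat -> \bar R) (lam K : R).

(** [risk M i z] is convertible to the growth of the expected weights. *)
Definition growth E : \bar R :=
  limn_esup (fun T : nat => (T%:R^-1)%:E * lne (E T)).

Lemma growth_ge0 E : (forall T, 1 <= E T) -> 0 <= growth E.
Proof.
move=> E1; rewrite /growth limn_esup_lim; apply: lime_ge; first exact: is_cvg_esups.
apply: nearW => n; apply: le_trans (ereal_sup_ubound _ : _ <= _); last first.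
  by exists n => /=.
by rewrite mule_ge0 ?lne_ge0// lee_fin invr_ge0.
Qed.

Lemma growth_lt E lam : growth E < lam%:E ->
  exists T0, forall T, (T0 <= T)%N -> E T <= (expR (lam * T%:R))%:E.
Proof.
rewrite /growth limn_esup_lim => lt.
have [n nlt] : exists n, esups (fun T : nat => (T%:R^-1)%:E * lne (E T)) n < lam%:E.
  apply: contrapT => /forallNP h; move: lt; rewrite ltNge => /negP; apply.
  apply: lime_ge; first exact: is_cvg_esups.
  by apply: nearW => n; rewrite leNgt; apply/negP/h.
exists n.+1 => T nT.
have : (T%:R^-1)%:E * lne (E T) <= lam%:E.
  apply: le_trans (ltW nlt); apply: ereal_sup_ubound.
  by exists T => //=; exact: ltnW.
have T0 : (0 < T%:R :> R)%R by rewrite ltr0n (leq_trans _ nT).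
rewrite lee_pdivrMl// -EFinM => h.
have [E0|E0] := leP (E T) 0; first by rewrite (le_trans E0)// lee_fin expR_ge0.
rewrite -[E T]lneK; last by rewrite in_itv/= ltW//= leey.
by rewrite -[leRHS]/(expeR (lam * T%:R)%:E) lee_expeR mulrC.
Qed.

Lemma growth_le E lam K : (0 < K)%R ->
  (forall T, 0 < E T) -> (forall T, E T <= (K * expR (lam * T%:R))%:E) ->
  growth E <= lam%:E.
Proof.
move=> K0 E0 EK; apply/lee_addgt0Pr => e e0.
have le T : (0 < T)%N -> (T%:R^-1)%:E * lne (E T) <= (lam + ln K / T%:R)%:E.
  move=> T0; have T0' : (0 < T%:R :> R)%R by rewrite ltr0n.
  rewrite lee_pdivrMl// -EFinM mulrDr mulrCA divff ?gt_eqF// mulr1.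
  have KT : (0 < K * expR (lam * T%:R))%R by rewrite mulr_gt0// expR_gt0.
  have -> : (T%:R * lam + ln K)%:E = lne (K * expR (lam * T%:R))%:E.
    by rewrite lne_EFin// lnM ?posrE ?expR_gt0// expRK addrC mulrC.
  rewrite lee_lne// in_itv/= leey andbT; first exact: ltW.
  by rewrite lee_fin ltW.
pose N := (Num.truncn (`|ln K| / e)%R).+1.
have small T : (N <= T)%N -> (ln K / T%:R <= e)%R.
  move=> NT; have T0 : (0 < T%:R :> R)%R by rewrite ltr0n (leq_trans _ NT).
  rewrite ler_pdivrMr// mulrC -ler_pdivrMr//.
  apply: le_trans (_ : `|ln K| / e <= _)%R; first by rewrite ler_pM2r ?invr_gt0// ler_norm.
  by apply/ltW/(lt_le_trans (truncnS_gt _)); rewrite ler_nat.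
rewrite /growth limn_esup_lim; apply: lime_le; first exact: is_cvg_esups.
exists N => // n /= nN; apply: ge_ereal_sup => _ [T /= nT <-].
have NT : (N <= T)%N by exact: leq_trans nT.
apply: le_trans (le T (leq_trans (ltn0Sn _) NT)) _.
by rewrite lee_fin lerD2l small.
Qed.

(** Comparison with a geometric series whose rate lies between the growth and
    [lam]. Monotonicity transfers the exponential bound to the finitely many
    times before it sets in, where the terms might otherwise be infinite. *)
Lemma growth_lt_sum E lam : (forall T, 1 <= E T) ->
  {homo E : m n / (m <= n)%N >-> m <= n} -> growth E < lam%:E ->
  exists K, forall m, \sum_(k < m) (expR (- lam) ^+ k)%:E * E k <= K%:E.
Proof.
move=> E1 End Elam; have g0 := growth_ge0 E1.
have gfin : growth E \is a fin_num by rewrite ge0_fin_numE// (lt_trans Elam)// ltry.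
(* any rate strictly between the growth of E and lam *)
pose mu := ((fine (growth E) + lam) / 2)%R.
have glam : (fine (growth E) < lam)%R by rewrite -lte_fin fineK.
have g0' : (0 <= fine (growth E))%R by rewrite fine_ge0.
have gmu : growth E < mu%:E by rewrite -(fineK gfin) lte_fin /mu; lra.
have mulam : (mu < lam)%R by rewrite /mu; lra.
have mu0 : (0 <= mu)%R by rewrite /mu; lra.
have [T0 HT0] := growth_lt gmu.
pose K := expR (mu * T0%:R); pose r := expR (mu - lam).
have EK T : E T <= (K * expR mu ^+ T)%:E.
  apply: le_trans (End _ _ (leq_maxl T T0)) _; apply: le_trans (HT0 _ (leq_maxr _ _)) _.
  rewrite lee_fin /K -expRM_natr -expRD ler_expR -mulrDr ler_wpM2l// -natrD ler_nat.
  by rewrite geq_max leq_addl leq_addr.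
have r0 : (0 <= r)%R by exact: expR_ge0.
have r1 : (r < 1)%R by rewrite /r -expR0 ltr_expR subr_lt0.
exists (K / (1 - r))%R => m.
apply: (@le_trans _ _ (\sum_(k < m) (K * r ^+ k)%:E)).
  apply: lee_sum => k _.
  apply: le_trans (lee_wpmul2l _ (EK k)) _; first by rewrite lee_fin exprn_ge0// expR_ge0.
  by rewrite -EFinM lee_fin mulrCA -exprMn -expRD addrC.
rewrite sumEFin lee_fin -mulr_sumr ler_wpM2l ?expR_ge0//.
rewrite -[leRHS]div1r ler_pdivlMr ?subr_gt0// mulrC.
have := subrX1 r m; set S := (\sum_(i < m) _)%R => rS.
have -> : ((1 - r) * S = 1 - r ^+ m)%R by rewrite -[(1 - r)%R]opprB mulNr -rS opprB.
by rewrite gerBl exprn_ge0.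
Qed.

End growth_rate.

(** * Supersolutions along paths *)

Section chain.
Context {R : realType} {X : completePseudoMetricType R}.
Variable M : dtcmp X.

Lemma series_trans_term (f : nat -> \bar R) i u j : (forall j, 0 <= f j) ->
  f j * trans M i u [set j] <= \sum_(k <oo) f k * trans M i u [set k].
Proof.
move=> f0; rewrite (nneseriesD1 (n := j))// => [|k _]; last by rewrite mule_ge0.
by rewrite leeDl// nneseries_ge0// => k _ _; rewrite mule_ge0.
Qed.

Lemma series_le_lop f i u : (forall j, 0 <= f j) -> adm M i u ->
  \sum_(k <oo) f k * trans M i u [set k] <= lop M f i u.
Proof.
move=> f0 Au; rewrite /lop -[leLHS]mul1e lee_wpmul2r ?series_trans_ge0//.
by rewrite lee_fin -expR0 ler_expR; exact: cost_ge0.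
Qed.

Section supersolution.
Variables (lam : R) (f : nat -> \bar R) (v : nat -> X).
Hypotheses (f0 : forall j, 0 <= f j) (vadm : stationary_policy M v).
Hypothesis fsuper : forall i, lop M f i (v i) <= (expR lam)%:E * f i.

Lemma super_step i j : f j * trans M i (v i) [set j] <= (expR lam)%:E * f i.
Proof.
apply: le_trans (fsuper i); apply: le_trans (series_le_lop f0 (vadm i)).
exact: series_trans_term.
Qed.

(** A Harnack inequality: a supersolution at [x] controls its values at all the
    states which are reachable under the selector [v]. *)
Lemma super_chain x s :
  step_prob M v x s * f (last x s) <= (expR lam ^+ size s)%:E * f x.
Proof.
elim: s x => [|y s ih] x /=; first by rewrite expr0.
rewrite -muleA.
apply: le_trans (lee_wpmul2l _ (ih y)) _; first exact: measure_ge0.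
rewrite muleCA exprSr EFinM -muleA lee_wpmul2l ?lee_fin ?exprn_ge0 ?expR_ge0//.
by rewrite muleC; exact: super_step.
Qed.

End supersolution.
End chain.

(** * Supersolutions are bounded away from zero *)

Section minimum_principle.
Context {R : realType} {X : completePseudoMetricType R}.
Variable M : dtcmp X.

Lemma series_trans1 i u : \sum_(j <oo) trans M i u [set j] = 1.
Proof.
rewrite -(probability_setT (trans M i u)).
rewrite (_ : setT = \bigcup_j [set j]); last first.
  by apply/seteqP; split => // j _; exists j.
by rewrite measure_semi_bigcup// => j k _ _ [l []] /= -> ->.
Qed.

Lemma series_trans_cst i u (c : R) :
  \sum_(j <oo) c%:E * trans M i u [set j] = c%:E.
Proof. by rewrite nneseriesZl// series_trans1 mule1. Qed.

(** The drift condition is about a series with terms of both signs; splitting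
    it bounds the mean of [W] and shows in particular that it is finite. *)
Lemma drift_mean (W : nat -> R) i u (e : R) : (forall j, (0 <= W j)%R) ->
  \sum_(j <oo) (W j - W i)%:E * trans M i u [set j] <= e%:E ->
  \sum_(j <oo) (W j)%:E * trans M i u [set j] <= (W i + e)%:E.
Proof.
move=> W0; set A := \sum_(j <oo) (W j)%:E * _.
have cA : (fun n => \sum_(0 <= j < n) (W j)%:E * trans M i u [set j]) @ \oo --> A.
  by apply: is_cvg_nneseries => j _ _; rewrite mule_ge0// lee_fin.
have cB : (fun n => \sum_(0 <= j < n) (W i)%:E * trans M i u [set j]) @ \oo -->
    (W i)%:E.
  rewrite -[X in _ --> X](series_trans_cst i u (W i)).
  by apply: is_cvg_nneseries => j _ _; rewrite mule_ge0// lee_fin.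
have D n : \sum_(0 <= j < n) (W j)%:E * trans M i u [set j] -
    \sum_(0 <= j < n) (W i)%:E * trans M i u [set j] =
    \sum_(0 <= j < n) (W j - W i)%:E * trans M i u [set j].
  pose p j := fine (trans M i u [set j]).
  have pE (c : nat -> R) : \sum_(0 <= j < n) (c j)%:E * trans M i u [set j] =
      (\sum_(0 <= j < n) c j * p j)%:E.
    by rewrite -sumEFin; apply: eq_bigr => j _; rewrite EFinM fineK// trans_fin_num.
  rewrite (pE W) (pE (fun=> W i)) (pE (fun j => W j - W i)%R) -EFinB -sumrB.
  by congr EFin; apply: eq_bigr => j _; rewrite mulrBl.
have := cvgeB (fin_num_adde_defl A (isT : (- (W i)%:E) \is a fin_num)) cA cB.
move=> /(_ _)/cvg_lim; under eq_fun do rewrite D.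
move=> -> //; rewrite leeBlDr// => /le_trans; apply.
by rewrite -EFinD addrC.
Qed.

(** Integrates a lower bound on a combination of [f] and [W], so that means of
    functions of both signs, such as [ln \o psi], never have to be formed. *)
Lemma mean_ge (f W : nat -> R) (al be ga : R) i u :
  (0 <= al)%R -> (0 <= be)%R -> (forall j, (0 <= f j)%R) ->
  (forall j, (0 <= W j)%R) -> (forall j, (ga <= al * f j + be * W j)%R) ->
  ga%:E <= al%:E * (\sum_(j <oo) (f j)%:E * trans M i u [set j]) +
           be%:E * (\sum_(j <oo) (W j)%:E * trans M i u [set j]).
Proof.
move=> al0 be0 f0 W0 h.
have t0 (c : nat -> R) : (forall j, (0 <= c j)%R) ->
    forall j, 0 <= (c j)%:E * trans M i u [set j].
  by move=> c0 j; rewrite mule_ge0// lee_fin.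
have [ga0|ga0] := leP ga 0%R.
  apply: (@le_trans _ _ 0); first by rewrite lee_fin.
  by rewrite adde_ge0// mule_ge0 ?lee_fin//; apply: nneseries_ge0 => j _ _; exact: t0.
rewrite -(series_trans_cst i u ga) -!nneseriesZl; try by move=> j _; exact: t0.
rewrite -nneseriesD; try by move=> j _ _; rewrite mule_ge0 ?lee_fin// t0.
apply: lee_nneseries => j _.
  by rewrite mule_ge0// lee_fin ltW.
by rewrite !muleA -!EFinM -ge0_muleDl ?lee_fin ?mulr_ge0// lee_wpmul2r// -EFinD lee_fin.
Qed.

Lemma ln_tangent (x y : R) : (0 < x)%R -> (0 < y)%R ->
  (ln x <= ln y + x / y - 1)%R.
Proof.
move=> x0 y0.
have xy0 : (0 < x / y)%R by exact: divr_gt0.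
have xy1 : (-1 < x / y - 1)%R by lra.
have := le_ln1Dx xy1.
by rewrite [(1 + _)%R]addrC subrK ln_div ?posrE//; lra.
Qed.

(** Let [y] be the mean of [psi] after one step. Where the cost exceeds [lam] by
    [de], the inequality for [psi] yields [ln (psi i) >= ln y + de], and by
    concavity [ln y] dominates the mean of [ln \o psi]: the logarithm turns the
    multiplicative gain [expR de] into an additive one, which beats the drift of
    [b * W]. Since [psi] is itself superharmonic there, adding it with a large
    relative weight [1 / ka] preserves the gain. *)
Lemma strict_supersolution (psi W : nat -> R) i u (lam de ep b ka mu : R) :
  (forall j, (0 < psi j)%R) -> (forall j, (0 <= W j)%R) ->
  (0 <= b)%R -> (0 < ka)%R -> (0 <= de)%R ->
  (exists j, 0 < trans M i u [set j]) ->
  lop M (EFin \o psi) i u <= (expR lam * psi i)%:E ->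
  (lam + de <= cost M i u)%R ->
  \sum_(j <oo) (W j - W i)%:E * trans M i u [set j] <= ep%:E ->
  (forall j, (mu <= psi j + ka * (ln (psi j) + b * W j))%R) ->
  (mu + ka * (de - b * ep) <= psi i + ka * (ln (psi i) + b * W i))%R.
Proof.
move=> psi0 W0 b0 ka0 de0 [j0 pj0] super hc /(drift_mean W0) PW hmu.
pose w := \sum_(j <oo) (W j)%:E * trans M i u [set j].
rewrite -/w in PW.
pose y := \sum_(j <oo) (psi j)%:E * trans M i u [set j].
have psiE j : 0 <= (EFin \o psi) j by rewrite lee_fin ltW.
have ys : (expR (lam + de))%:E * y <= (expR lam * psi i)%:E.
  apply: le_trans super; rewrite lee_wpmul2r ?lee_fin ?ler_expR//.
  exact: series_trans_ge0.
have ygt0 : 0 < y.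
  apply: lt_le_trans (series_trans_term M i u j0 psiE).
  by rewrite mule_gt0// lte_fin.
have yle : y <= (expR (- de) * psi i)%:E.
  move: ys; rewrite -lee_pdivlMl ?expR_gt0// => /le_trans; apply.
  by rewrite -EFinM lee_fin -expRN mulrA -expRD opprD addrAC addNr add0r.
have yfin : y \is a fin_num.
  by rewrite ge0_fin_numE ?ltW// (le_lt_trans yle)// ltry.
have w0 : 0 <= w by apply: nneseries_ge0 => j _ _; rewrite mule_ge0// lee_fin.
have wfin : w \is a fin_num by rewrite ge0_fin_numE// (le_lt_trans PW)// ltry.
pose yr := fine y; pose wr := fine w.
have yE : y = yr%:E by rewrite fineK.
have wE : w = wr%:E by rewrite fineK.
have yr0 : (0 < yr)%R by rewrite -lte_fin -yE.
have wle : (wr <= W i + ep)%R by rewrite -lee_fin -wE.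
have yrle : (yr <= expR (- de) * psi i)%R by rewrite -lee_fin -yE.
have psiy : (yr <= psi i)%R.
  apply: (le_trans yrle); rewrite ler_piMl ?(ltW (psi0 i))//.
  by rewrite -expR0 ler_expR oppr_le0.
have lny : (ln yr + de <= ln (psi i))%R.
  have p0 : (0 < expR (- de) * psi i)%R by rewrite mulr_gt0 ?expR_gt0 ?psi0.
  have := yrle; rewrite -ler_ln ?posrE// lnM ?posrE ?expR_gt0// expRK; lra.
have mean : (mu - ka * (ln yr - 1) <= (1 + ka / yr) * yr + (ka * b) * wr)%R.
  rewrite -lee_fin [leRHS](_ : _ = (1 + ka / yr)%:E * y + (ka * b)%:E * w); last first.
    by rewrite yE wE.
  apply: mean_ge => //.
  - by rewrite addr_ge0// divr_ge0// ltW.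
  - by rewrite mulr_ge0// ltW.
  (* Jensen's inequality, through the tangent of ln at the mean yr *)
  - move=> j; have := ler_wpM2l (ltW ka0) (ln_tangent (psi0 j) yr0).
    by have := hmu j; rewrite !mulrDr mulrDl; lra.
have lnk := ler_wpM2l (ltW ka0) lny.
have wk := ler_wpM2l (mulr_ge0 (ltW ka0) b0) wle.
have yk : ((1 + ka / yr) * yr = yr + ka)%R by rewrite mulrDl mul1r divfK ?gt_eqF.
rewrite yk in mean; lra.
Qed.

(** If the infimum were below [m], adding [th] to it would give a larger lower
    bound. The infimum need not be attained. *)
Lemma min_principle (f : nat -> R) (N : nat) (L m th : R) : (0 < th)%R ->
  (forall i, (L <= f i)%R) -> (forall i, (i < N)%N -> (m <= f i)%R) ->
  (forall mu, (forall j, (mu <= f j)%R) ->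
     forall i, (N <= i)%N -> (mu + th <= f i)%R) ->
  forall i, (m <= f i)%R.
Proof.
move=> th0 fL fm step.
have lb : has_lbound (range f) by exists L => _ [j _ <-].
have inf_le j : (inf (range f) <= f j)%R by apply: ge_inf => //; exists j.
have : (Num.min m (inf (range f) + th) <= inf (range f))%R.
  apply: lb_le_inf; first by exists (f 0%N), 0%N.
  move=> _ [i _ <-]; rewrite ge_min; have [iN|Ni] := ltnP i N.
    by rewrite fm.
  by rewrite (step _ inf_le i Ni) orbT.
rewrite ge_min => /orP[mi i|]; first exact: le_trans (inf_le i).
by rewrite gerDl leNgt th0.
Qed.

End minimum_principle.

Section bounded_below.
Context {R : realType} {X : completePseudoMetricType R}.
Variable M : dtcmp X.
Variables (lam eta : R) (psi : nat -> R) (v : nat -> X).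
Hypotheses (psi0 : forall i, (0 < psi i)%R) (vadm : stationary_policy M v).
Hypothesis super : forall i,
  lop M (EFin \o psi) i (v i) <= (expR lam * psi i)%:E.
Hypothesis eta0 : (0 < eta)%R.
Hypothesis down : forall i u, adm M i.+1 u -> eta%:E <= trans M i.+1 u [set i].

Let psiE j : 0 <= (EFin \o psi) j. Proof. by rewrite lee_fin ltW. Qed.

Lemma super_down i : (psi 0 * (expR (- lam) * eta) ^+ i <= psi i)%R.
Proof.
elim: i => [|i ih]; first by rewrite expr0 mulr1.
have : (eta%:E * (psi i)%:E <= (expR lam * psi i.+1)%:E).
  apply: le_trans (super_step psiE vadm super i.+1 i).
  by rewrite muleC; apply: lee_wpmul2l; [exact: psiE|exact: down].
rewrite -EFinM lee_fin => h.
rewrite exprSr mulrA; apply: (@le_trans _ _ (psi i * (expR (- lam) * eta))%R).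
  by rewrite ler_wpM2r// mulr_ge0 ?expR_ge0// ltW.
by rewrite mulrCA expRN -ler_pdivlMl ?invr_gt0 ?expR_gt0// invrK mulrC.
Qed.

Lemma finite_lower_bound n : exists2 m : R, (0 < m)%R &
  forall i, (i < n)%N -> (m <= psi i)%R.
Proof.
elim: n => [|n [m m0 mle]]; first by exists 1%R.
exists (Num.min m (psi n)); first by rewrite lt_min m0 psi0.
move=> i; rewrite ltnS leq_eqVlt => /predU1P[->|/mle h].
  by rewrite ge_min lexx orbT.
by rewrite ge_min h.
Qed.

(** Positivity alone would not
    exclude that [psi] tends to zero along a transient path. The downward steps
    show that [psi] decays at most geometrically, so [L = ln psi + b W] is
    bounded below for large [b]; by [strict_supersolution] the minimum principle
    applies to [psi + ka * L] for every [ka > 0], and [ka] is sent to zero. *)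
Lemma super_bounded_below (W g : nat -> R) (de : R) (N : nat) :
  (0 < de)%R ->
  (forall i u, (N <= i)%N -> adm M i u -> (lam + de <= cost M i u)%R) ->
  (forall i, (1 <= W i)%R) -> (\forall i \near \oo, (i.+1%:R <= W i)%R) ->
  g @ \oo --> (0 : R)%R ->
  (forall i, ereal_sup [set \sum_(j <oo) (W j - W i)%:E * trans M i u [set j]
              | u in adm M i] <= (g i)%:E) ->
  exists2 m : R, (0 < m)%R & forall i, (m <= psi i)%R.
Proof.
move=> de0 hc W1 [N2 _ HN2] g0 hg.
pose q := (expR (- lam) * eta)%R.
have q0 : (0 < q)%R by rewrite mulr_gt0 ?expR_gt0.
pose b := (`|ln q| + 1)%R.
have b0 : (0 < b)%R by rewrite /b ltr_wpDl.
(* the drift of b * W may consume half of the gain de *)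
pose ep := (de / (2 * b))%R.
have ep0 : (0 < ep)%R by rewrite divr_gt0// mulr_gt0.
have bep : (b * ep = de / 2)%R.
  by rewrite /ep; field; rewrite gt_eqF.
have [N1 _ HN1] := cvgr_lt _ g0 _ ep0.
(* the term 1 keeps state 0, which has no downward step, in the finite set *)
pose N' := maxn N (maxn N1 1).
have [m m0 mle] := finite_lower_bound N'.
exists m => // i.
pose L i := (ln (psi i) + b * W i)%R.
pose c0 := (ln (psi 0%N) - b * N2%:R)%R.
have Lc0 j : (c0 <= L j)%R.
  have := super_down j; rewrite -/q -ler_ln ?posrE ?mulr_gt0 ?exprn_gt0//.
  rewrite lnM ?posrE ?exprn_gt0// lnXn// -mulr_natl => h.
  have qb : (- b <= ln q)%R.
    by have := ler_norm (- ln q); rewrite normrN /b; lra.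
  have jq : (- (b * j%:R) <= j%:R * ln q)%R.
    by rewrite -mulNr mulrC ler_wpM2l.
  have Wj : (j%:R <= W j + N2%:R :> R)%R.
    have [jN|Nj] := leqP N2 j.
      apply: le_trans (_ : W j <= _)%R; last by rewrite lerDl.
      by apply: le_trans (HN2 _ jN); rewrite ler_nat.
    apply: le_trans (_ : N2%:R <= _)%R; first by rewrite ler_nat ltnW.
    by rewrite lerDr (le_trans _ (W1 j)).
  have := ler_wpM2l (ltW b0) Wj; rewrite /L /c0 mulrDr; lra.
have key ka : (0 < ka)%R -> (m + ka * c0 <= psi i + ka * L i)%R.
  move=> ka0; apply: (min_principle (f := (fun j => psi j + ka * L j)%R)
    (N := N') (L := (ka * c0)%R) (th := (ka * (de - b * ep))%R)).
  - by rewrite bep mulr_gt0//; lra.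
  - move=> j; have := ler_wpM2l (ltW ka0) (Lc0 j); have := psi0 j; lra.
  - by move=> j jN; rewrite lerD ?mle// ler_wpM2l// ltW.
  - move=> mu hmu [|j].
      by rewrite /N' !geq_max ltnn !andbF.
    rewrite /N' !geq_max => /andP[Nj /andP[N1j _]].
    apply: (strict_supersolution (M := M) (u := v j.+1) (lam := lam)) => //.
    + by move=> k; apply: le_trans (W1 k).
    + exact: ltW.
    + exact: ltW.
    + by exists j; apply: lt_le_trans (down (vadm _)); rewrite lte_fin.
    + exact: hc.
    + have gj : (g j.+1 < ep)%R by exact: HN1.
      apply: (@le_trans _ _ (g j.+1)%:E); last by rewrite lee_fin ltW.
      by apply: le_trans (hg j.+1); apply: ereal_sup_ubound; exists (v j.+1).
rewrite leNgt; apply/negP => psim.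
(* letting ka tend to zero, by contradiction with an explicit small ka *)
pose D := (L i - c0 + 1)%R.
have D0 : (0 < D)%R by have := Lc0 i; rewrite /D; lra.
have ka0 : (0 < (m - psi i) / D)%R by rewrite divr_gt0// subr_gt0.
have := key _ ka0; set ka := (_ / D)%R => h.
have kD : (ka * D = m - psi i)%R by rewrite /ka divfK// gt_eqF.
have : (ka * D = ka * L i - ka * c0 + ka)%R by rewrite /D; ring.
by rewrite kD -/ka; move: ka0; rewrite -/ka; lra.
Qed.

End bounded_below.

(** * Normalized supersolutions and their limit *)

Section limit.
Context {R : realType} {X : completePseudoMetricType R}.
Variable M : dtcmp X.
Hypothesis hA : cond_A M.
Variable eta : R.
Hypothesis eta0 : (0 < eta)%R.
Hypothesis down : forall i u, adm M i.+1 u -> eta%:E <= trans M i.+1 u [set i].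
Hypothesis up : forall v j, stationary_policy M v -> j <> 0%N ->
  exists s : seq nat, 0 < step_prob M v 0 (rcons s j).

(** Finiteness propagates from [i0] to state [0] along the downward steps, and
    from there to every state along the paths given by [up]. *)
Lemma value_fin_num lam i0 : value M lam i0 < +oo ->
  forall i, value M lam i \is a fin_num.
Proof.
move=> vi0; have /all_sig2[v vadm vsuper] i := cid2 (value_super hA lam i).
have v0 j : 0 <= value M lam j by apply: le_trans (value_ge1 M lam j).
have key (p : \bar R) x y C : 0 < p -> p * value M lam x <= C%:E * value M lam y ->
    value M lam y < +oo -> value M lam x < +oo.
  move=> p0 le yfin; rewrite ltey; apply/negP => /eqP xy; move: le.
  rewrite xy gt0_muley// leye_eq => /eqP e.
  have : C%:E * value M lam y \is a fin_num.
    by rewrite fin_numM// ge0_fin_numE.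
  by rewrite e.
have v0fin : value M lam 0 < +oo.
  elim: i0 vi0 => // i ih vi; apply: ih.
  apply: (key (trans M i.+1 (v i.+1) [set i]) i i.+1 (expR lam)) vi.
    by apply: lt_le_trans (down (vadm _)); rewrite lte_fin.
  by rewrite muleC; exact: super_step.
move=> i; rewrite ge0_fin_numE//.
have [->//|/eqP i_neq0] := eqVneq i 0%N.
have [s sp] := up vadm i_neq0.
apply: (key _ i 0%N _ sp) v0fin.
rewrite -{2}(last_rcons 0%N s i).
exact: super_chain.
Qed.

Lemma lopZ (c : R) f i u : (0 <= c)%R -> (forall j, 0 <= f j) ->
  lop M (fun j => c%:E * f j) i u = c%:E * lop M f i u.
Proof.
move=> c0 f0; rewrite /lop muleCA; congr (_ * _).
rewrite -nneseriesZl; last by move=> j _; rewrite mule_ge0.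
by apply: eq_eseriesr => j _; rewrite muleA.
Qed.

Lemma normalized_super lam : (exists i, value M lam i < +oo) ->
  exists (psi : nat -> R) (v : nat -> X),
  [/\ psi 0%N = 1%R, forall i, (0 < psi i)%R, stationary_policy M v &
      forall i, lop M (EFin \o psi) i (v i) <= (expR lam * psi i)%:E].
Proof.
move=> [i0 /value_fin_num vfin].
have /all_sig2[v vadm vsuper] i := cid2 (value_super hA lam i).
pose V i := fine (value M lam i).
have VE i : value M lam i = (V i)%:E by rewrite fineK.
have V1 i : (1 <= V i)%R by rewrite -lee_fin -VE value_ge1.
have V0 i : (0 < V i)%R by exact: lt_le_trans (V1 i).
exists (fun i => (V 0%N)^-1 * V i)%R, v; split => //.
- by rewrite mulVf// gt_eqF.
- by move=> i; rewrite mulr_gt0// invr_gt0.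
move=> i.
have -> : EFin \o (fun i => (V 0%N)^-1 * V i)%R =
    (fun j => ((V 0%N)^-1)%:E * value M lam j).
  by apply/funext => j; rewrite VE.
rewrite lopZ; last 2 first.
- by rewrite invr_ge0 ltW.
- by move=> j; rewrite VE lee_fin ltW.
rewrite mulrCA EFinM; apply: lee_wpmul2l; first by rewrite lee_fin invr_ge0 ltW.
by rewrite EFinM -VE.
Qed.

Lemma step_prob_cvg (U : set_system nat) (v_ : nat -> nat -> X) v x s :
  UltraFilter U -> (forall n, stationary_policy M (v_ n)) ->
  stationary_policy M v -> (forall i, (fun n => v_ n i) @ U --> v i) ->
  step_prob M v x s \is a fin_num /\
  (fun n => step_prob M (v_ n) x s) @ U --> step_prob M v x s.
Proof.
move=> UU v_adm vadm v_v; elim: s x => [|y s ih] x /=.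
  by split => //; exact: cvg_cst.
have [fy cy] := ih y; split; first by rewrite fin_numM// trans_fin_num.
apply: cvgeM => //; first by apply: mule_def_fin => //; exact: trans_fin_num.
exact: (trans_cvg hA UU (vadm x) (fun n => v_adm n x) (v_v x)).
Qed.

(** The downward steps bound the normalized supersolutions from below. The paths
    from state [0] under the limit policy bound them from above: path
    probabilities depend continuously on the policy, so along the ultrafilter
    they stay above half of their positive limits. *)
Lemma super_limit (lam lmax : R) (lam_ : nat -> R) (psi_ : nat -> nat -> R)
    (v_ : nat -> nat -> X) :
  (forall n, (lam_ n <= lmax)%R) -> lam_ @ \oo --> lam ->
  (forall n, [/\ psi_ n 0%N = 1%R, forall i, (0 < psi_ n i)%R,
      stationary_policy M (v_ n) &
      forall i, lop M (EFin \o psi_ n) i (v_ n i) <= (expR (lam_ n) * psi_ n i)%:E]) ->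
  exists2 psi : nat -> R, (forall i, (0 < psi i)%R) &
    forall i, exists2 u, adm M i u & lop M (EFin \o psi) i u <= (expR lam * psi i)%:E.
Proof.
move=> lam_le lam_cvg h; have [U UU sU] := ultra_on_oo.
have psi1 n : psi_ n 0%N = 1%R by have [] := h n.
have psi0 n i : (0 < psi_ n i)%R by have [_ /(_ i)] := h n.
have v_adm n : stationary_policy M (v_ n) by have [] := h n.
have super n i : lop M (EFin \o psi_ n) i (v_ n i) <= (expR (lam_ n) * psi_ n i)%:E.
  by have [_ _ _ /(_ i)] := h n.
have psiE n j : 0 <= (EFin \o psi_ n) j by rewrite lee_fin ltW.
have /all_sig2[v vadm v_v] i : {x | adm M i x & (fun n => v_ n i) @ U --> x}.
  apply: cid2; apply: ultra_compact_cvg; first exact: compact_adm.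
  by apply: (filterE (F := U)) => n; exact: v_adm.
have lower n i : ((expR (- lmax) * eta) ^+ i <= psi_ n i)%R.
  apply: le_trans (super_down (psi0 n) (v_adm n) (super n) eta0 down i).
  rewrite psi1 mul1r lerXn2r ?nnegrE ?mulr_ge0 ?expR_ge0 ?(ltW eta0)//.
  by rewrite ler_pM2r// ler_expR lerN2.
have upper i : exists C : R, U [set n | (psi_ n i <= C)%R].
  have [->|/eqP i_neq0] := eqVneq i 0%N.
    by exists 1%R; apply: (filterE (F := U)) => n /=; rewrite psi1.
  have [s sp] := up vadm i_neq0.
  have [sfin scvg] := step_prob_cvg 0%N (rcons s i) UU v_adm vadm v_v.
  set p := step_prob M v _ _ in sp sfin scvg.
  have p0 : (0 < fine p)%R by rewrite fine_gt0// sp ltey_eq sfin.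
  have ph : (fine p / 2 < fine p)%R by lra.
  exists (expR lmax ^+ size (rcons s i) / (fine p / 2))%R.
  have fcvg : (fun n => fine (step_prob M (v_ n) 0%N (rcons s i))) @ U --> fine p.
    by apply: fine_cvg; rewrite fineK.
  have ev : U [set n | (fine p / 2 < fine (step_prob M (v_ n) 0%N (rcons s i)))%R].
    exact: cvgr_gt _ fcvg _ ph.
  apply: (filterS (F := U)) ev => n /= pn.
  have snf : step_prob M (v_ n) 0%N (rcons s i) \is a fin_num.
    by have [] := step_prob_cvg 0%N (rcons s i) UU (fun=> v_adm n) (v_adm n) (fun=> cvg_cst _).
  have := super_chain (psiE n) (v_adm n) (fun i => super n i) 0%N (rcons s i).
  rewrite last_rcons /= psi1 mule1 -(fineK snf) -EFinM lee_fin => le.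
  rewrite ler_pdivlMr ?divr_gt0// mulrC.
  apply: (@le_trans _ _ (fine (step_prob M (v_ n) 0%N (rcons s i)) * psi_ n i)%R).
    by rewrite ler_wpM2r// ltW.
  apply: (le_trans le); rewrite lerXn2r ?nnegrE ?expR_ge0//.
  by rewrite ler_expR.
have /all_sig2[psi psi_low psi_cvg] i : {x | ((expR (- lmax) * eta) ^+ i <= x)%R &
    (fun n => psi_ n i) @ U --> x}.
  apply: cid2; have [C UC] := upper i.
  pose c := ((expR (- lmax) * eta) ^+ i)%R.
  have [||x] := @ultra_compact_cvg _ `[c, C]%classic U
    (fun n => psi_ n i) UU.
  - exact: segment_compact.
  - by apply: (filterS (F := U)) UC => n /= nC; rewrite in_itv/= lower.
  by rewrite /= in_itv/= => /andP[cx _] cv; exists x.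
have lamU : lam_ @ U --> lam by move=> V /lam_cvg; exact: sU.
exists psi.
  by move=> i; apply: lt_le_trans (psi_low i); rewrite exprn_gt0// mulr_gt0// expR_gt0.
move=> i; exists (v i) => //.
apply: (lop_le_lim hA UU (vadm i) (fun n => v_adm n i) (v_v i)
  (f_ := fun n => EFin \o psi_ n) (a_ := fun n => (expR (lam_ n) * psi_ n i)%R)).
- exact: psiE.
- move=> j; apply: cvg_EFin; first by apply: (filterE (F := U)).
  exact: psi_cvg.
- apply: cvgM; last exact: psi_cvg.
  by apply: continuous_cvg; [exact: continuous_expR|].
- by move=> n; exact: super.
Qed.

End limit.

(** * Verification and optimality *)

Section stationary_control.
Context {R : realType} {X : completePseudoMetricType R}.
Variable M : dtcmp X.
Hypothesis hA : cond_A M.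

Lemma stationary_admissible v : stationary_policy M v -> admissible M (stationary v).
Proof.
move=> vadm t; split => [|h _]; last exact: vadm.
apply: measurable_funTS.
by apply: (measurableT_comp (f := v : nat -> borel X)) => //; exact: measurable_snd.
Qed.

(** [expR (- lam * T) * weight T * psi (state T)] is a supermartingale under the
    stationary control, and [psi >= m] removes [psi] from its expectation. *)
Lemma pcost_stationary_le (lam m : R) (psi : nat -> R) v i
    (Pr : probability (@path_space R X) R) T :
  stationary_policy M v -> is_path_law M i (stationary v) Pr ->
  (0 < m)%R -> (forall j, (m <= psi j)%R) ->
  (forall j, lop M (EFin \o psi) j (v j) <= (expR lam * psi j)%:E) ->
  pcost M Pr T <= (psi i / m * expR (lam * T%:R))%:E.
Proof.
move=> vadm lawPr m0 mpsi super.
have zadm := stationary_admissible vadm.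
have mD := measurable_feasible_paths M.
have psiE j : 0 <= (EFin \o psi) j by rewrite lee_fin (le_trans (ltW m0)).
have w0 t w : 0 <= (weight M t w)%:E by rewrite lee_fin weight_ge0.
have mpsiT t : measurable_fun (feasible_paths M) (fun w => (psi (state t w))%:E).
  by apply: measurable_funTS; exact: (measurable_state_fun (EFin \o psi)).
have grow : \int[Pr]_(w in feasible_paths M) ((weight M T w)%:E * (psi (state T w))%:E)
    <= (expR lam ^+ T * psi i)%:E.
  elim: T => [|T ih].
    by rewrite expr0 mul1r (integral_weight0 hA zadm lawPr psiE).
  rewrite (integral_weightS hA zadm lawPr T psiE).
  have [N [mN N0 Nz]] := null_off_control lawPr.
  have l0 j u : 0 <= lop M (EFin \o psi) j u by exact: lop_ge0.
  have mlv : measurable_fun (feasible_paths M)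
      (fun w => lop M (EFin \o psi) (state T w) (v (state T w))).
    apply: measurable_funTS.
    exact: (measurable_state_fun (fun j => lop M (EFin \o psi) j (v j))).
  rewrite (integral_null_eq (N := N) (B := feasible_paths M)
    (g := fun w => (weight M T w)%:E *
       lop M (EFin \o psi) (state T w) (v (state T w)))) //.
  - apply: (@le_trans _ _ (\int[Pr]_(w in feasible_paths M)
        ((expR lam)%:E * ((weight M T w)%:E * (psi (state T w))%:E)))).
      apply: ge0_le_integral => //.
      + by move=> w _; exact: mule_ge0.
      + apply: emeasurable_funM => //; exact: measurable_EFin_weight.
      + apply: measurable_funeM; apply: emeasurable_funM => //.
        exact: measurable_EFin_weight.
      + move=> w _; rewrite [leRHS]muleCA; apply: lee_wpmul2l => //; exact: super.
    rewrite ge0_integralZl//; last 2 first.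
    + by apply: emeasurable_funM => //; exact: measurable_EFin_weight.
    + by move=> w _; apply: mule_ge0 => //; exact: psiE.
    by rewrite exprS -mulrA [leRHS]EFinM; apply: lee_wpmul2l.
  - by move=> w /Nz /(feasible_of_control zadm).
  - by move=> w /Nz /(feasible_of_control zadm).
  - apply: emeasurable_funM; first exact: measurable_EFin_weight.
    exact: measurable_lop_path.
  - by apply: emeasurable_funM => //; exact: measurable_EFin_weight.
  - by move=> w _; exact: mule_ge0.
  - by move=> w _; exact: mule_ge0.
  - by move=> w /Nz ->.
have : m%:E * pcost M Pr T <= (expR lam ^+ T * psi i)%:E.
  apply: le_trans grow; rewrite -ge0_integralZl//; last 2 first.
  - exact: measurable_EFin_weight.
  - by rewrite lee_fin ltW.
  apply: ge0_le_integral => //.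
  - by move=> w _; rewrite mule_ge0// lee_fin ltW.
  - by apply: measurable_funeM; exact: measurable_EFin_weight.
  - by apply: emeasurable_funM => //; exact: measurable_EFin_weight.
  - by move=> w _; rewrite muleC lee_wpmul2l// lee_fin.
rewrite -lee_pdivlMl// => /le_trans; apply.
rewrite -EFinM lee_fin expRM_natr le_eqVlt; apply/orP; left; apply/eqP; ring.
Qed.

End stationary_control.

Section rates.
Context {R : realType} {X : completePseudoMetricType R}.
Variable M : dtcmp X.
Hypotheses (hausX : hausdorff_space X) (hA : cond_A M).

Lemma path_cost_ge1 i z T : admissible M z -> 1 <= pcost M (path_law M i z) T.
Proof. by move=> zadm; exact: (pcost_ge1 hA zadm (path_lawP hausX i zadm)). Qed.

Lemma risk_ge0 i z : admissible M z -> 0 <= risk M i z.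
Proof. by move=> zadm; apply: growth_ge0 => T; exact: path_cost_ge1. Qed.

Lemma lambda_star_ge0 : 0 <= lambda_star M.
Proof.
apply: le_ereal_inf_tmp => _ [i _ <-]; apply: le_ereal_inf_tmp => _ [z zadm <-].
exact: risk_ge0.
Qed.

Lemma lambda_star_le i z : admissible M z -> lambda_star M <= risk M i z.
Proof.
move=> zadm; apply: (@le_trans _ _ (ereal_inf [set risk M i z | z in admissible M])).
  by apply: ereal_inf_lbound; exists i.
by apply: ereal_inf_lbound; exists z.
Qed.

Lemma lambda_m_le i v : stationary_policy M v -> lambda_m M <= risk M i (stationary v).
Proof.
move=> vadm; apply: (@le_trans _ _
    (ereal_inf [set risk M i (stationary v) | v in stationary_policy M])).
  by apply: ereal_inf_lbound; exists i.
by apply: ereal_inf_lbound; exists v.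
Qed.

Lemma lambda_star_le_m : lambda_star M <= lambda_m M.
Proof.
apply: le_ereal_inf_tmp => _ [i _ <-]; apply: le_ereal_inf_tmp => _ [v vadm <-].
exact: lambda_star_le (stationary_admissible vadm).
Qed.

(** The value is at most the discounted total cost of any control, and some
    control has a rate below [lam] from some initial state. *)
Lemma value_finite lam : lambda_star M < lam%:E -> exists i, value M lam i < +oo.
Proof.
move=> /ereal_inf_lt[_ [i _ <-]] /ereal_inf_lt[_ [z zadm <-]] zlam.
have law := path_lawP hausX i zadm.
have [K HK] := growth_lt_sum (fun T => path_cost_ge1 i T zadm)
  (pcost_nd hA (path_law M i z)) zlam.
exists i; apply: le_lt_trans (ltry K); apply: ge_ereal_sup => _ [n _ <-].
exact: le_trans (viter_le_costs hA zadm law lam n) (HK n).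
Qed.

End rates.

Lemma near_monotone_gap (R : realType) (c : nat -> set R) (l : R) :
  l%:E < limn_einf (fun n => ereal_inf
    [set ereal_inf [set x%:E | x in c k] | k in [set k | n <= k]%N]) ->
  exists2 de : R, (0 < de)%R &
    exists N, forall k x, (N <= k)%N -> c k x -> (l + de <= x)%R.
Proof.
set u := (fun n : nat => _); rewrite limn_einf_lim => lt.
have [n ln] : exists n, l%:E < einfs u n.
  apply: contrapT => /forallNP h; move: lt; rewrite ltNge => /negP; apply.
  apply: lime_le; first exact: is_cvg_einfs.
  by apply: nearW => n; rewrite leNgt; apply/negP/h.
have lun : l%:E < u n.
  by apply: (lt_le_trans ln); apply: ereal_inf_lbound; exists n => /=.
have ule k x : (n <= k)%N -> c k x -> u n <= x%:E.
  move=> nk cx; apply: (@le_trans _ _ (ereal_inf [set x%:E | x in c k])).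
    by apply: ereal_inf_lbound; exists k.
  by apply: ereal_inf_lbound; exists x.
have [uy|un] := eqVneq (u n) +oo.
  exists 1%R => //; exists n => k x nk cx.
  by have := ule _ _ nk cx; rewrite uy leye_eq.
have ufin : u n \is a fin_num.
  by rewrite fin_numE un andbT gt_eqF// (lt_trans _ lun)// ltNyr.
exists (fine (u n) - l)%R; first by rewrite subr_gt0 -lte_fin fineK.
by exists n => k x nk cx; rewrite addrC subrK -lee_fin fineK//; exact: ule nk cx.
Qed.

Theorem theorem2p4 (R : realType) (X : completePseudoMetricType R)
    (hausX : hausdorff_space X) (sepX : separable X) (M : dtcmp X)
    (hA : cond_A M) (hN : cond_N M) (hW : cond_W M)
    (hirr : forall v, stationary_policy M v -> irreducible M v) :
  (exists psi : nat -> R,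
     [/\ forall i, (0 < psi i)%R,
         forall i, exists2 u, bellman_min M psi i u &
           bellman M psi i u <= expeR (lambda_star M) * (psi i)%:E &
         forall v, (forall i, bellman_min M psi i (v i)) ->
           optimal M (stationary v)]) /\
  lambda_star M = lambda_m M.
Proof.
have [[W [g [W1 Wbig g0 drift]]] [eta eta0 down] _ paths] := hW.
have [_ lam_gap] := hN.
have up v j : stationary_policy M v -> j <> 0%N ->
    exists s : seq nat, 0 < step_prob M v 0 (rcons s j).
  by move=> vadm j0; have [s [_ _ sp]] := paths j.+1 v j vadm (ltnSn j) j0; exists s.
have ls_fin : lambda_star M \is a fin_num.
  rewrite ge0_fin_numE ?lambda_star_ge0//.
  apply: le_lt_trans (lambda_star_le_m M) _.
  by apply: (lt_le_trans lam_gap); exact: leey.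
pose l := fine (lambda_star M); have lE : lambda_star M = l%:E by rewrite fineK.
have [de de0 [N hc]] : exists2 de : R, (0 < de)%R &
    exists N, forall k x, (N <= k)%N -> [set cost M k u | u in adm M k] x ->
      (l + de <= x)%R.
  apply: near_monotone_gap; rewrite -lE.
  apply: (le_lt_trans (lambda_star_le_m M)).
  rewrite [X in _ < X](_ : _ = limn_einf (fun n => ereal_inf
    [set ereal_inf [set (cost M k u)%:E | u in adm M k] | k in [set k | n <= k]%N]))//.
  congr limn_einf; apply/funext => n; congr ereal_inf.
  by apply: eq_imagel => k _; congr ereal_inf; rewrite image_comp.
(* the values are known to be finite only at rates above l *)
pose lam_ n := (l + n.+1%:R^-1)%R.
have lam_cvg : lam_ @ \oo --> l.
  rewrite -[X in _ --> X]addr0; apply: cvgD; first exact: cvg_cst.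
  exact: cvg_harmonic.
have lam_le n : (lam_ n <= l + 1)%R by rewrite lerD2l invf_le1// ler1n.
have lam_gt n : lambda_star M < (lam_ n)%:E by rewrite lE lte_fin ltrDl invr_gt0.
have [psi_ psi_P] := choice (fun n =>
  normalized_super hA eta0 down up (value_finite hausX hA (lam_gt n))).
have [v_ v_P] := choice psi_P.
have [psi psi0 psi_super] := super_limit hA eta0 down up lam_le lam_cvg v_P.
have psiE j : 0 <= (EFin \o psi) j by rewrite lee_fin ltW.
have selector v : (forall i, bellman_min M psi i (v i)) ->
    stationary_policy M v /\ forall i, risk M i (stationary v) <= l%:E.
  move=> vmin; have vadm : stationary_policy M v by move=> i; have [] := vmin i.
  have super i : lop M (EFin \o psi) i (v i) <= (expR l * psi i)%:E.
    have [u Au] := psi_super i; apply: le_trans.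
    by have [_ /(_ u Au)] := vmin i.
  have [m m0 mpsi] : exists2 m : R, (0 < m)%R & forall i, (m <= psi i)%R.
    apply: (super_bounded_below (N := N) psi0 vadm super eta0 down de0 _ W1 Wbig g0 drift).
    by move=> i u Ni Au; apply: (hc i _ Ni); exists u.
  split => // i; have zadm := stationary_admissible vadm.
  apply: (growth_le (K := (psi i / m)%R)); first exact: divr_gt0.
    by move=> T; apply: lt_le_trans (path_cost_ge1 hausX hA i T zadm).
  move=> T; exact: (pcost_stationary_le hA T vadm (path_lawP hausX i zadm) m0 mpsi super).
have /all_sig2[v0 v0adm v0min] i := cid2 (lop_min hA i psiE).
have v0sel i : bellman_min M psi i (v0 i) by split; [exact: v0adm|exact: v0min].
split; last first.
  apply/eqP; rewrite eq_le lambda_star_le_m/= lE.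
  have [v0pol /(_ 0%N) h] := selector v0 v0sel.
  exact: le_trans (lambda_m_le 0%N v0pol) h.
exists psi; split => //.
  move=> i; exists (v0 i) => //.
  have [u Au] := psi_super i; rewrite lE -EFinM; apply: le_trans.
  exact: v0min.
move=> v /selector[vadm vrisk]; split; first exact: stationary_admissible.
move=> i; apply/eqP; rewrite eq_le {1}lE vrisk/=.
by apply: lambda_star_le; exact: stationary_admissible.
Qed.
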